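(* The elementary (complete first-order) theory of Young's lattice $\langle\mathcal P,\le\rangle$ is undecidable and inherently non-finitely axiomatizable.
   Context: $\mathcal P$ is the set of all integer partitions, including the empty partition; a partition is a nonincreasing finite sequence of positive integers. Young's lattice is $\langle\mathcal P,\le\rangle$ where $(s_1,\dots,s_r)\le(n_1,\dots,n_t)$ iff $r\le t$ and $s_i\le n_i$ for all $i\le r$ (containment of Young diagrams). *)

(* Defs.v *)
From HB Require Import structures.
From mathcomp Require Import all_boot.
Set Implicit Arguments. Unset Strict Implicit. Unset Printing Implicit Defensive.

Definition is_partition (s : seq nat) : bool :=
  sorted geq s && all (fun x => 0 < x) s.

Definition partition := {s : seq nat | is_partition s}.

Definition young_le (s t : seq nat) : bool :=
  (size s <= size t) && [forall i : 'I_(size s), nth 0 s i <= nth 0 t i].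

Definition Yle (p q : partition) : Prop := young_le (sval p) (sval q).

Definition empty_partition : partition := exist _ [::] isT.

(* First-order logic: the base language has one binary relation <=    *)
(* (plus equality); extra relation symbols (indexed by nat, arbitrary  *)
(* arity) are allowed for expanded languages.  Variables: de Bruijn.  *)

Inductive form : Type :=
| Fle  : nat -> nat -> form
| Feq  : nat -> nat -> form
| Frel : nat -> seq nat -> form
| Fbot : form
| Fimp : form -> form -> form
| Fall : form -> form.

Fixpoint base (p : form) : bool :=
  match p with
  | Frel _ _ => false
  | Fimp p q => base p && base q
  | Fall p => base p
  | _ => true
  end.

Fixpoint bound (n : nat) (p : form) : bool :=
  match p with
  | Fle x y | Feq x y => (x < n) && (y < n)
  | Frel _ a => all (fun x => x < n) a
  | Fbot => true
  | Fimp p q => bound n p && bound n q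
  | Fall p => bound n.+1 p
  end.

Definition sentence (p : form) : bool := bound 0 p.

Definition scons (D : Type) (d : D) (e : nat -> D) (n : nat) : D :=
  if n is k.+1 then e k else d.

Fixpoint sat (D : Type) (le : D -> D -> Prop) (I : nat -> seq D -> Prop)
    (e : nat -> D) (p : form) : Prop :=
  match p with
  | Fle x y => le (e x) (e y)
  | Feq x y => e x = e y
  | Frel r a => I r (map e a)
  | Fbot => False
  | Fimp p q => sat le I e p -> sat le I e q
  | Fall p => forall d : D, sat le I (scons d e) p
  end.

(* truth in Young's lattice (base sentences do not use I) *)
Definition Young_sat (p : form) : Prop :=
  forall e : nat -> partition, sat Yle (fun _ _ => False) e p.

Definition ThY (p : form) : Prop := base p /\ sentence p /\ Young_sat p.

Fixpoint form_eqb (p q : form) : bool :=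
  match p, q with
  | Fle x y, Fle x' y' => (x == x') && (y == y')
  | Feq x y, Feq x' y' => (x == x') && (y == y')
  | Frel r a, Frel r' a' => (r == r') && (a == a')
  | Fbot, Fbot => true
  | Fimp p1 p2, Fimp q1 q2 => form_eqb p1 q1 && form_eqb p2 q2
  | Fall p1, Fall q1 => form_eqb p1 q1
  | _, _ => false
  end.

Lemma form_eqP : Equality.axiom form_eqb.
Proof.
elim=> [x y|x y|r a||p1 IH1 p2 IH2|p1 IH1] [x' y'|x' y'|r' a'||q1 q2|q1] /=;
  try by constructor.
- by apply: (iffP andP) => [[/eqP-> /eqP->]|[-> ->]].
- by apply: (iffP andP) => [[/eqP-> /eqP->]|[-> ->]].
- by apply: (iffP andP) => [[/eqP-> /eqP->]|[-> ->]].
- apply: (iffP andP) => [[/IH1-> /IH2->]|[<- <-]]; split; [exact/IH1|exact/IH2].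
- by apply: (iffP (IH1 q1)) => [->|[]].
Qed.

HB.instance Definition _ := hasDecEq.Build form form_eqP.

(* semantic consequence from a set of sentences (in any expansion),
   over all structures with nonempty domain *)
Definition entails (Sigma : seq form) (p : form) : Prop :=
  forall (D : Type) (d0 : D) (le : D -> D -> Prop) (I : nat -> seq D -> Prop),
    (forall s, s \in Sigma -> forall e : nat -> D, sat le I e s) ->
    forall e : nat -> D, sat le I e p.

Inductive prf : Type :=
| PZero : prf
| PSucc : prf
| PProj : nat -> prf
| PComp : prf -> seq prf -> prf
| PPrec : prf -> prf -> prf
| PMin  : prf -> prf.

Inductive eval : prf -> seq nat -> nat -> Prop :=
| ev_zero v : eval PZero v 0
| ev_succ v : eval PSucc v (nth 0 v 0).+1
| ev_proj i v : eval (PProj i) v (nth 0 v i)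
| ev_comp f gs v ws r :
    evals gs v ws -> eval f ws r -> eval (PComp f gs) v r
| ev_prec0 f g v r : eval f v r -> eval (PPrec f g) (0 :: v) r
| ev_precS f g n v r r' :
    eval (PPrec f g) (n :: v) r -> eval g [:: n, r & v] r' ->
    eval (PPrec f g) (n.+1 :: v) r'
| ev_min f v n :
    eval f (n :: v) 0 ->
    (forall m, m < n -> exists k, 0 < k /\ eval f (m :: v) k) ->
    eval (PMin f) v n
with evals : seq prf -> seq nat -> seq nat -> Prop :=
| evs_nil v : evals [::] v [::]
| evs_cons g gs v w ws : eval g v w -> evals gs v ws -> evals (g :: gs) v (w :: ws).

Definition decidable_nat (P : nat -> Prop) : Prop :=
  exists f : prf, forall n : nat,
    (P n -> eval f [:: n] 1) /\ (~ P n -> eval f [:: n] 0).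

Definition cpair (x y : nat) : nat := ((x + y) * (x + y).+1)./2 + y.

Fixpoint code_list (l : seq nat) : nat :=
  if l is x :: l' then (cpair x (code_list l')).+1 else 0.

Fixpoint code (p : form) : nat :=
  match p with
  | Fle x y => cpair 0 (cpair x y)
  | Feq x y => cpair 1 (cpair x y)
  | Frel r a => cpair 2 (cpair r (code_list a))
  | Fbot => cpair 3 0
  | Fimp p q => cpair 4 (cpair (code p) (code q))
  | Fall p => cpair 5 (code p)
  end.

Definition decidable_form (T : form -> Prop) : Prop :=
  decidable_nat (fun n => exists p, code p = n /\ T p).

(* inherently non-finitely axiomatizable: there is no finite set of
   sentences, in any finite expansion of the language by new relation
   symbols, whose consequences in the base language are exactly T *)
Definition inherently_nonfinitely_axiomatizable (T : form -> Prop) : Prop :=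
  ~ exists Sigma : seq form,
      all sentence Sigma /\
      forall p, base p -> sentence p -> (T p <-> entails Sigma p).

(* Main.v *)
Require Import Defs.
From mathcomp Require Import all_boot.
From mathcomp Require Import zify.
From Stdlib Require Import Classical ClassicalEpsilon.
Import Defs.
Set Implicit Arguments. Unset Strict Implicit. Unset Printing Implicit Defensive.

(** Weak second-order arithmetic is interpreted in Young's lattice without
    parameters. The join-irreducible partitions are the rectangles, and the
    number n is coded by the staircase (n+1, n, ..., 1). Comparing an
    (a+1) x (b+1) rectangle with staircases gives min(a, b), max(a, b) and
    a + b in a way that is invariant under conjugation, so that addition is
    definable; and since an arbitrary finite set can be realized as the set of
    min(a, b) over the corners of a partition, so are divisibility, the pairing
    function and definitions by recursion. Hence the graphs of recursive
    functions are definable, and Tarski's diagonal argument shows that no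
    definable set of numbers agrees with truth on the codes of sentences. This
    refutes decidability. It also refutes finite axiomatizability in an expanded
    language, because consequence from a finite set of sentences is definable:
    by weak König's lemma a countermodel exists iff for every N there is a
    finite approximation, below N, to a Hintikka set with Henkin witnesses. *)

Arguments cpair : simpl never.

(** * Renaming of variables, and the dependence of satisfaction on the environment *)

Definition ren_up (r : nat -> nat) (i : nat) : nat := if i is j.+1 then (r j).+1 else 0.

Fixpoint ren (r : nat -> nat) (p : form) : form :=
  match p with
  | Fle x y => Fle (r x) (r y)
  | Feq x y => Feq (r x) (r y)
  | Frel k a => Frel k (map r a)
  | Fbot => Fbot
  | Fimp p q => Fimp (ren r p) (ren r q)
  | Fall p => Fall (ren (ren_up r) p)
  end.

Section Sat.
Variables (D : Type) (le : D -> D -> Prop) (I : nat -> seq D -> Prop).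

Lemma sat_ext p e e' : (forall i, e i = e' i) -> sat le I e p <-> sat le I e' p.
Proof.
elim: p e e' => [x y|x y|r a||p IHp q IHq|p IHp] e e' ee' /=; rewrite ?ee' //.
- by rewrite (eq_map ee').
- by have := IHp _ _ ee'; have := IHq _ _ ee'; tauto.
- have E d i : scons d e i = scons d e' i by case: i => /=.
  by split=> H d; have := IHp _ _ (E d); have := H d; tauto.
Qed.

Lemma sat_bound p n e e' :
  bound n p -> (forall i, i < n -> e i = e' i) -> sat le I e p <-> sat le I e' p.
Proof.
elim: p n e e' => [x y|x y|r a||p IHp q IHq|p IHp] n e e' /=.
- by move=> /andP[xn yn] ee'; rewrite !ee'.
- by move=> /andP[xn yn] ee'; rewrite !ee'.
- move=> /allP an ee'.
  by have /eq_in_map -> : {in a, e =1 e'} by move=> i /an /ee'.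
- by [].
- by move=> /andP[/IHp Hp /IHq Hq] ee'; have := Hp _ _ ee'; have := Hq _ _ ee'; tauto.
- move=> bp ee'.
  have E d i : i < n.+1 -> scons d e i = scons d e' i by case: i => //= i /ee'.
  by split=> H d; have := IHp _ _ _ bp (E d); have := H d; tauto.
Qed.

Lemma sat_ren p r e : sat le I e (ren r p) <-> sat le I (fun i => e (r i)) p.
Proof.
elim: p r e => [x y|x y|k a||p IHp q IHq|p IHp] r e //=.
- by rewrite -map_comp.
- by have := IHp r e; have := IHq r e; tauto.
- have E d i : scons d e (ren_up r i) = scons d (fun j => e (r j)) i by case: i.
  split=> H d; have := IHp (ren_up r) (scons d e); have := sat_ext p (E d);
    by have := H d; tauto.
Qed.
End Sat.

Lemma base_ren r p : base (ren r p) = base p.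
Proof. by elim: p r => //= p IHp q IHq r; rewrite IHp IHq. Qed.

Lemma bound_ren n r p : (forall i, r i < n) -> bound n (ren r p).
Proof.
elim: p n r => [x y|x y|k a||p IHp q IHq|p IHp] n r rn //=; rewrite ?rn ?IHp ?IHq //.
- by rewrite all_map; apply/allP => i _ /=.
- by move=> [|i] //=; rewrite ltnS.
Qed.

Lemma bound_leq m n p : m <= n -> bound m p -> bound n p.
Proof.
elim: p m n => [x y|x y|r a||p IHp q IHq|p IHp] m n mn //=.
- by move=> /andP[xm ym]; rewrite !(leq_trans _ mn).
- by move=> /andP[xm ym]; rewrite !(leq_trans _ mn).
- by apply: sub_all => i im; apply: leq_trans mn.
- by move=> /andP[/IHp-> // /IHq->].
- exact: IHp.
Qed.

(** * Partitions as nonincreasing functions *)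

Definition fn (p : partition) (i : nat) : nat := nth 0 (sval p) i.

Lemma fn_geq p i j : i <= j -> fn p j <= fn p i.
Proof.
case: p => s /=; rewrite /fn /= => /andP[ss _] ij.
case: (ltnP j (size s)) => [js|js]; last by rewrite nth_default.
have gtr : transitive geq by move=> a b c /= ab bc; apply: leq_trans bc ab.
have rr : reflexive geq by move=> a /=.
by apply: (sorted_leq_nth gtr rr 0 ss); rewrite ?inE //=; apply: leq_ltn_trans js.
Qed.

Lemma fn_gt0 p i : (0 < fn p i) = (i < size (sval p)).
Proof.
case: p => s /=; rewrite /fn /= => /andP[_ /allP s0].
case: (ltnP i (size s)) => [si|si]; last by rewrite nth_default.
by apply: s0; apply: mem_nth.
Qed.

Lemma fn_inj p q : (forall i, fn p i = fn q i) -> p = q.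
Proof.
move=> pq; apply: val_inj => /=.
have spq : size (sval p) = size (sval q).
  by apply/eqP; rewrite eqn_leq; apply/andP; split; rewrite leqNgt -fn_gt0;
    [rewrite pq|rewrite -pq]; rewrite fn_gt0 ltnn.
by apply: (eq_from_nth spq) => i _; apply: pq.
Qed.

(** Parts are positive and [fn] is 0 past the end, so the pointwise inequality already forces the
    condition on lengths. *)
Lemma YleP p q : Yle p q <-> forall i, fn p i <= fn q i.
Proof.
split=> [/andP[sz /forallP H] i|H].
  case: (ltnP i (size (sval p))) => [ip|ip]; first exact: (H (Ordinal ip)).
  by rewrite /fn (nth_default _ ip).
apply/andP; split; last by apply/forallP => i; apply: H.
rewrite leqNgt; apply/negP => qp; have := H (size (sval q)).
rewrite leqNgt => /negP[]; apply: (@leq_ltn_trans 0); last by rewrite fn_gt0.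
by rewrite leqNgt fn_gt0 ltnn.
Qed.

Lemma Yle_anti p q : Yle p q -> Yle q p -> p = q.
Proof.
by move=> /YleP pq /YleP qp; apply: fn_inj => i; apply/eqP; rewrite eqn_leq pq qp.
Qed.

(** Cutting [f] at its first zero leaves only positive parts. *)
Lemma mk_partition (f : nat -> nat) N :
  (forall i, f i.+1 <= f i) -> f N = 0 -> {p : partition | forall i, fn p i = f i}.
Proof.
move=> fS fN.
have fle i j : i <= j -> f j <= f i.
  by move=> /subnK <-; elim: (j - i) => // k; apply: leq_trans; apply: fS.
have ex0 : exists n, f n == 0 by exists N; apply/eqP.
case: (ex_minnP ex0) => K /eqP fK Kmin.
have part : is_partition (mkseq f K).
  apply/andP; split.
    apply/(sortedP 0) => i; rewrite size_mkseq => iK.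
    by rewrite !nth_mkseq ?(ltnW iK) //; apply: fS.
  apply/allP => x /mapP[i]; rewrite mem_iota /= => iK ->.
  by rewrite lt0n; apply: contraL iK => /Kmin; rewrite -leqNgt.
exists (exist _ (mkseq f K) part) => i; rewrite /fn /=.
case: (ltnP i K) => [iK|Ki]; first by rewrite nth_mkseq.
by rewrite nth_default ?size_mkseq //; have := fle _ _ Ki; lia.
Qed.

(** * Rectangles and staircases, and their first-order characterizations *)

Lemma rect_proof a b : {p | forall i, fn p i = if i <= a then b.+1 else 0}.
Proof.
apply: (@mk_partition _ a.+1) => [i|]; rewrite ?ltnn //.
by case: (leqP i a); case: (leqP i.+1 a); lia.
Qed.
Definition rect a b := sval (rect_proof a b).
Lemma fn_rect a b i : fn (rect a b) i = if i <= a then b.+1 else 0.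
Proof. exact: (svalP (rect_proof a b)). Qed.

Lemma num_proof n : {p | forall i, fn p i = n.+1 - i}.
Proof. by apply: (@mk_partition _ n.+1) => [i|]; lia. Qed.
Definition num n := sval (num_proof n).
Lemma fn_num n i : fn (num n) i = n.+1 - i.
Proof. exact: (svalP (num_proof n)). Qed.

(** Only the corner cell of the rectangle matters, since the earlier rows of [p] are at least as
    long. *)
Lemma rect_Yle a b p : Yle (rect a b) p <-> b < fn p a.
Proof.
rewrite YleP; split=> [/(_ a)|ba i]; rewrite fn_rect; first by rewrite leqnn.
by case: (leqP i a) => // ia; have := fn_geq p ia; lia.
Qed.

Lemma rect_rect a b c d : Yle (rect a b) (rect c d) <-> a <= c /\ b <= d.
Proof. by rewrite rect_Yle fn_rect; case: (leqP a c); lia. Qed.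

Lemma rect_num a b n : Yle (rect a b) (num n) <-> a + b <= n.
Proof. by rewrite rect_Yle fn_num; lia. Qed.

Lemma num_rect n a b : Yle (num n) (rect a b) <-> n <= a /\ n <= b.
Proof.
rewrite YleP; split=> [H|[na nb] i]; last by rewrite fn_num fn_rect; case: (leqP i _); lia.
have := H 0; have := H n; rewrite !fn_num !fn_rect leq0n.
by case: (leqP n a); lia.
Qed.

Lemma num_num n m : Yle (num n) (num m) <-> n <= m.
Proof.
rewrite YleP; split=> [/(_ 0)|nm i]; rewrite !fn_num; lia.
Qed.

Lemma num_inj : injective num.
Proof. by move=> n m nm; have := fn_num n 0; rewrite nm fn_num; lia. Qed.

Definition Ylt p q := Yle p q /\ ~ Yle q p.

(** A greatest element strictly below [p] is the first-order form of complete join-irreducibility;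
    it excludes the empty partition. *)
Definition jirr p := exists q, Ylt q p /\ forall r, Ylt r p -> Yle r q.

(** A partition is the union of the rectangles inside it: if [p] were none of them, all would lie
    below [q], and hence so would [p]. *)
Lemma jirrP p : jirr p <-> exists a b, p = rect a b.
Proof.
split=> [[q [[qp npq] qmax]]|[a [b ->]]].
  apply: NNPP => nr; apply: npq; apply/YleP => i.
  case E: (fn p i) => [//|b].
  have rp : Yle (rect i b) p by rewrite rect_Yle E.
  apply/rect_Yle; apply: qmax; split => // pr.
  by apply: nr; exists i, b; apply: Yle_anti.
(* The rectangle without its corner cell. *)
have [q qE] : {q | forall i, fn q i = if i <= a then b.+1 - (i == a) else 0}.
  apply: (@mk_partition _ a.+1) => [i|]; rewrite ?ltnn //.
  by case: (leqP i a); case: (leqP i.+1 a); lia.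
exists q; split; [split|].
- by apply/YleP => i; rewrite qE fn_rect; case: (leqP i _); lia.
- by rewrite rect_Yle qE eqxx leqnn; lia.
move=> r [/YleP rp npr]; apply/YleP => i; rewrite qE.
have := rp i; rewrite fn_rect.
case: (i =P a) => [->|_]; last by case: (leqP i a); lia.
rewrite leqnn.
by move=> H; rewrite leqNgt; apply/negP => H'; apply: npr; rewrite rect_Yle; lia.
Qed.

Lemma jirr_rect a b : jirr (rect a b). Proof. by apply/jirrP; exists a, b. Qed.

Definition jcover p q :=
  jirr q /\ Ylt p q /\ forall r, jirr r -> Ylt p r -> Yle r q -> Yle q r.

(* On rectangles, [rect a.+1 b] is below [s] iff [rect a b.+1] is: both cover
   [rect a b]. This forces each part of [s] to be one less than the previous. *)
Definition stair s := (exists p, Ylt p s) /\ forall p q r,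
  jirr p -> jirr q -> Ylt p q -> Yle q s -> jcover p r -> Yle r s.

Lemma stairP s : stair s <-> exists n, s = num n.
Proof.
split=> [[[p0 [_ n0]] H]|[n ->]]; last first.
  split.
    exists empty_partition; split; first by apply/YleP => i; rewrite /fn /= nth_nil.
    by move=> /YleP /(_ 0); rewrite fn_num /fn nth_nil; lia.
  move=> _ _ r /jirrP[a [b ->]] /jirrP[c [d ->]] [].
  rewrite rect_num !rect_rect => ac nca cd [/jirrP[e [f ->]]].
  move=> [[]]; rewrite !rect_rect => ae nea Hmin; rewrite rect_num.
  (* [rect e f] contains [rect a b] enlarged by one row or one column, so minimality of the cover
     gives e + f <= a + b + 1 <= c + d <= n. *)
  have [ltae|leae] := ltnP a e.
    have := Hmin (rect a.+1 b) (jirr_rect _ _); rewrite /Ylt !rect_rect.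
    by move=> []; lia.
  have := Hmin (rect a b.+1) (jirr_rect _ _); rewrite /Ylt !rect_rect.
  by move=> []; lia.
(* The two covers of [rect a b] enter [s] together: [col] trades the extra row for an extra column,
   and [row] does the reverse. *)
have step a : fn s a.+1 = (fn s a).-1.
  have col b : b < fn s a.+1 -> b.+1 < fn s a.
    rewrite -!rect_Yle => Hs.
    apply: (H (rect a b) _ _ (jirr_rect _ _) (jirr_rect _ _) _ Hs).
      by rewrite /Ylt !rect_rect; lia.
    split; first exact: jirr_rect.
    split; first by rewrite /Ylt !rect_rect; lia.
    by move=> _ /jirrP[c [d ->]]; rewrite /Ylt !rect_rect; lia.
  have row b : b.+1 < fn s a -> b < fn s a.+1.
    rewrite -!rect_Yle => Hs.
    apply: (H (rect a b) _ _ (jirr_rect _ _) (jirr_rect _ _) _ Hs).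
      by rewrite /Ylt !rect_rect; lia.
    split; first exact: jirr_rect.
    split; first by rewrite /Ylt !rect_rect; lia.
    by move=> _ /jirrP[c [d ->]]; rewrite /Ylt !rect_rect; lia.
  have := col (fn s a.+1).-1; have := row (fn s a).-2.
  by have := fn_geq s (leqnSn a); lia.
have s0 : 0 < fn s 0.
  rewrite lt0n; apply/eqP => s0; apply: n0; apply/YleP => i.
  by have := fn_geq s (leq0n i); lia.
exists (fn s 0).-1; apply: fn_inj => i; rewrite fn_num prednK //.
by elim: i => [|i IHi]; rewrite ?subn0 // step IHi; lia.
Qed.

Lemma stair_num n : stair (num n). Proof. by apply/stairP; exists n. Qed.

Definition min_is r x := Yle x r /\ forall y, stair y -> Yle y r -> Yle y x.
(** The least rectangle around a staircase is its bounding square, so for a staircase [x] this says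
    that [r] fits into that square. *)
Definition max_below r x := forall q, jirr q -> Yle x q -> Yle r q.
Definition max_is r x := max_below r x /\ forall y, stair y -> max_below r y -> Yle x y.
Definition sum_is r x := Yle r x /\ forall y, stair y -> Yle r y -> Yle x y.

Lemma min_isP a b n : min_is (rect a b) (num n) <-> minn a b = n.
Proof.
split=> [[/num_rect ab H]|<-].
  by have /H := stair_num (minn a b); rewrite num_rect num_num; lia.
split; first by rewrite num_rect; lia.
by move=> _ /stairP[m ->]; rewrite num_rect num_num; lia.
Qed.

Lemma max_belowP a b n : max_below (rect a b) (num n) <-> maxn a b <= n.
Proof.
split=> [/(_ _ (jirr_rect n n))|ab _ /jirrP[c [d ->]]]; rewrite num_rect rect_rect; lia.
Qed.

Lemma max_isP a b n : max_is (rect a b) (num n) <-> maxn a b = n.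
Proof.
split=> [[/max_belowP ab H]|<-].
  by have /H := stair_num (maxn a b); rewrite max_belowP num_num; lia.
split; first by rewrite max_belowP.
by move=> _ /stairP[m ->]; rewrite max_belowP num_num.
Qed.

Lemma sum_isP a b n : sum_is (rect a b) (num n) <-> a + b = n.
Proof.
split=> [[/rect_num ab H]|<-].
  by have /H := stair_num (a + b); rewrite rect_num num_num; lia.
split; first by rewrite rect_num.
by move=> _ /stairP[m ->]; rewrite rect_num num_num.
Qed.

(** Conjugation is an automorphism, so the two sides of a rectangle cannot be told apart; the
    disjunction lets [x] and [y] be its minimum and maximum in either order. *)
Definition plus_is x y z := exists r,
  jirr r /\ ((min_is r x /\ max_is r y) \/ (min_is r y /\ max_is r x)) /\ sum_is r z.

Lemma plus_isP x y z : plus_is (num x) (num y) (num z) <-> x + y = z.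
Proof.
split=> [[_ [/jirrP[a [b ->]]]]|xyz].
  by rewrite !min_isP !max_isP sum_isP; lia.
exists (rect x y); split; first exact: jirr_rect.
by rewrite !min_isP !max_isP sum_isP; lia.
Qed.

Definition corner p r :=
  jirr r /\ Yle r p /\ forall q, jirr q -> Yle r q -> Yle q p -> Yle q r.

Lemma cornerP p a b : corner p (rect a b) <-> fn p a = b.+1 /\ fn p a.+1 < fn p a.
Proof.
split=> [[_ [/rect_Yle bp H]]|[pa pS]].
  have := H _ (jirr_rect a b.+1); have := H _ (jirr_rect a.+1 b).
  by rewrite !rect_rect !rect_Yle; have := fn_geq p (leqnSn a); lia.
split; first exact: jirr_rect.
split; first by rewrite rect_Yle pa.
move=> _ /jirrP[c [d ->]]; rewrite !rect_rect rect_Yle => -[ac bd] dc.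
case: (ltngtP a c) ac => // [lt_ac|eq_ac] _; first by have := fn_geq p lt_ac; lia.
by move: dc; rewrite -eq_ac; lia.
Qed.

(* A partition codes the finite set of the numbers [minn a b] for its corners
   [rect a b]. *)
Definition memY p x := exists r, corner p r /\ min_is r x.

Lemma memYP p n : memY p (num n) <->
  exists a, fn p a.+1 < fn p a /\ minn a (fn p a).-1 = n.
Proof.
split=> [[r [cr]]|[a [pa <-]]].
  have /jirrP[a [b E]] := cr.1; move: cr; rewrite E cornerP min_isP => -[pa lt] mn.
  by exists a; rewrite pa /=; split => //; rewrite -pa.
exists (rect a (fn p a).-1); rewrite cornerP min_isP; split=> //; lia.
Qed.

(** Row [i] gets length N plus the number of elements of [X] in [i, N), or 0 if there are none. The
    length drops exactly at the rows in [X], and nonzero parts exceed N, so the minimum at a corner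
    is its row index. *)
Lemma memY_fin (X : nat -> bool) N : exists p, forall n, memY p (num n) <-> (n < N) && X n.
Proof.
pose c i := count X (iota i (N - i)).
have cS i : i < N -> c i = X i + c i.+1.
  by move=> iN; rewrite /c -[N - i]prednK ?subn_gt0 //= subnS.
have cN i : N <= i -> c i = 0 by rewrite /c -subn_eq0 => /eqP->.
pose f i := if c i == 0 then 0 else N + c i.
have [p pE] : {p | forall i, fn p i = f i}.
  apply: (@mk_partition f N) => [i|]; last by rewrite /f cN.
  rewrite /f; case: (ltnP i N) => iN; last by rewrite !cN // leqW.
  by rewrite (cS i iN); do 2!case: eqP; lia.
exists p => n; rewrite memYP; split=> [[a []]|/andP[nN Xn]].
  rewrite !pE /f; case: (ltnP a N) => aN; last by rewrite !cN ?ltnn // leqW.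
  rewrite (cS a aN); case Xa: (X a) => /=; last by rewrite ltnn.
  by move=> _ <-; rewrite (minn_idPl _) ?aN //; lia.
by exists n; rewrite !pE /f (cS n nN) Xn /=; split; try case: eqP; lia.
Qed.

(** * Definability in Young's lattice *)

Notation Ysat := (sat Yle (fun _ _ => False)).

(* [h] is the coding of the objects of type [D] by partitions; it is used with
   [id] and with [num]. *)
Definition definable (D : Type) (h : D -> partition) (P : (nat -> D) -> Prop) :=
  exists2 p, base p & forall v, Ysat (fun i => h (v i)) p <-> P v.

Definition range_definable (D : Type) (h : D -> partition) :=
  exists2 p, base p & forall e, Ysat e p <-> exists d, e 0 = h d.

Section Definable.
Variables (D : Type) (h : D -> partition).
Implicit Types P Q : (nat -> D) -> Prop.

Lemma definable_ext Q P : (forall v, P v <-> Q v) -> definable h Q -> definable h P.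
Proof. by move=> PQ [p bp Hp]; exists p => // v; rewrite Hp PQ. Qed.

Lemma definable_False : definable h (fun _ => False).
Proof. by exists Fbot. Qed.

Lemma definable_imp P Q :
  definable h P -> definable h Q -> definable h (fun v => P v -> Q v).
Proof.
move=> [p bp Hp] [q bq Hq]; exists (Fimp p q) => [|v] /=; first by rewrite bp.
by rewrite Hp Hq.
Qed.

Lemma definable_not P : definable h P -> definable h (fun v => ~ P v).
Proof. by move=> dP; apply: definable_imp definable_False. Qed.

Lemma definable_and P Q :
  definable h P -> definable h Q -> definable h (fun v => P v /\ Q v).
Proof.
move=> dP dQ; apply: (definable_ext (Q := fun v => ~ (P v -> ~ Q v))).
  by move=> v; tauto.
by apply: definable_not; apply: definable_imp => //; apply: definable_not.
Qed.

Lemma definable_or P Q :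
  definable h P -> definable h Q -> definable h (fun v => P v \/ Q v).
Proof.
move=> dP dQ; apply: (definable_ext (Q := fun v => ~ P v -> Q v)).
  by move=> v; tauto.
by apply: definable_imp => //; apply: definable_not.
Qed.

Lemma definable_iff P Q :
  definable h P -> definable h Q -> definable h (fun v => P v <-> Q v).
Proof. by move=> dP dQ; apply: definable_and; apply: definable_imp. Qed.

Lemma definable_ren (r : nat -> nat) P :
  definable h P -> definable h (fun v => P (fun i => v (r i))).
Proof.
move=> [p bp Hp]; exists (ren r p) => [|v]; first by rewrite base_ren.
by rewrite sat_ren Hp.
Qed.

Hypothesis h_range : range_definable h.

(** The quantifier is relativized to the formula that defines the range of [h]. *)
Lemma definable_all (Q : (nat -> D) -> D -> Prop) :
  definable h (fun v => Q (fun i => v i.+1) (v 0)) ->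
  definable h (fun v => forall d, Q v d).
Proof.
case: h_range => r br Hr [q bq Hq].
exists (Fall (Fimp r q)) => [|v] /=; first by rewrite br.
have E d : Ysat (scons (h d) (fun i => h (v i))) q <-> Q v d.
  rewrite -(Hq (scons d v)); apply: sat_ext.
  by case.
split=> [H d|H d /Hr[d' /= ->]]; last exact/E.
by apply/E/H/Hr; exists d.
Qed.

Lemma definable_ex (Q : (nat -> D) -> D -> Prop) :
  definable h (fun v => Q (fun i => v i.+1) (v 0)) ->
  definable h (fun v => exists d, Q v d).
Proof.
move=> dQ; apply: (definable_ext (Q := fun v => ~ forall d, ~ Q v d)).
  move=> v; split=> [[d Qd] /(_ d)//|nQ].
  by apply: NNPP => nE; apply: nQ => d Qd; apply: nE; exists d.
by apply/definable_not/definable_all/definable_not.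
Qed.

End Definable.

Lemma range_id : range_definable (@id partition).
Proof. by exists (Feq 0 0) => // e; split=> // _; exists (e 0). Qed.

Notation ydef := (definable (@id partition)).

Lemma ydef_Yle x y : ydef (fun e => Yle (e x) (e y)).
Proof. by exists (Fle x y). Qed.

Lemma ydef_eq x y : ydef (fun e => e x = e y).
Proof. by exists (Feq x y). Qed.

Create HintDb def.

(** Builds the defining formula along the connectives and quantifiers, leaving as goals the atoms
    that the hints do not settle. *)
Ltac define_step :=
  cbv beta; first
  [ solve [auto 10 with def]
  | apply: definable_not
  | apply: definable_and
  | apply: definable_or
  | apply: definable_iff
  | apply: definable_imp
  | apply: definable_all; first by auto with def
  | apply: definable_ex; first by auto with def ].
Ltac define := repeat define_step.
#[local] Hint Resolve range_id ydef_Yle ydef_eq : def.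

Lemma ydef_Ylt x y : ydef (fun e => Ylt (e x) (e y)).
Proof. rewrite /Ylt; define. Qed.
#[local] Hint Resolve ydef_Ylt : def.

Lemma ydef_jirr x : ydef (fun e => jirr (e x)).
Proof. rewrite /jirr; define. Qed.
#[local] Hint Resolve ydef_jirr : def.

Lemma ydef_stair x : ydef (fun e => stair (e x)).
Proof. rewrite /stair /jcover; define. Qed.
#[local] Hint Resolve ydef_stair : def.

Lemma ydef_min_is x y : ydef (fun e => min_is (e x) (e y)).
Proof. rewrite /min_is; define. Qed.
#[local] Hint Resolve ydef_min_is : def.

Lemma ydef_max_is x y : ydef (fun e => max_is (e x) (e y)).
Proof. rewrite /max_is /max_below; define. Qed.
#[local] Hint Resolve ydef_max_is : def.

Lemma ydef_plus_is x y z : ydef (fun e => plus_is (e x) (e y) (e z)).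
Proof. rewrite /plus_is /sum_is; define. Qed.

Lemma ydef_memY x y : ydef (fun e => memY (e x) (e y)).
Proof. rewrite /memY /corner; define. Qed.

Lemma range_num : range_definable num.
Proof. by have [p bp Hp] := ydef_stair 0; exists p => // e; rewrite Hp stairP. Qed.
#[local] Hint Resolve range_num ydef_memY : def.

(** * Definable relations and functions on numbers *)

Notation ndef := (definable num).

Lemma ndef_ydef Q (P : (nat -> nat) -> Prop) :
  ydef Q -> (forall v, Q (fun i => num (v i)) <-> P v) -> ndef P.
Proof. by move=> [p bp Hp] QP; exists p => // v; rewrite Hp QP. Qed.

(** Definability of the graph of [t]: variable 0 holds the value, so the arguments move up by
    one. *)
Definition tdef (t : (nat -> nat) -> nat) := ndef (fun v => t (fun i => v i.+1) = v 0).

Lemma ndef_subst (Q : nat -> (nat -> nat) -> Prop) t :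
  ndef (fun v => Q (v 0) (fun i => v i.+1)) -> tdef t -> ndef (fun v => Q (t v) v).
Proof.
move=> dQ dt; apply: (definable_ext (Q := fun v => exists n, t v = n /\ Q n v)).
  by move=> v; split=> [|[n [<-]]] //; exists (t v).
by apply: (definable_ex range_num); apply: definable_and.
Qed.

Lemma tdef_ren r t : tdef t -> tdef (fun v => t (fun i => v (r i))).
Proof. exact: (definable_ren (ren_up r)). Qed.

Lemma ndef_rel1 (R : nat -> Prop) t :
  ndef (fun v => R (v 0)) -> tdef t -> ndef (fun v => R (t v)).
Proof. by move=> dR dt; apply: (ndef_subst (Q := fun n _ => R n) dR dt). Qed.

Lemma ndef_rel2 (R : nat -> nat -> Prop) t u :
  ndef (fun v => R (v 0) (v 1)) -> tdef t -> tdef u -> ndef (fun v => R (t v) (u v)).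
Proof.
move=> dR dt du; apply: (ndef_subst (Q := fun n v => R n (u v)) _ dt).
apply: (ndef_subst (Q := fun n v => R (v 0) n) _ (tdef_ren _ du)).
exact: (definable_ren (fun i => if i is 0 then 1 else 0) dR).
Qed.

Lemma ndef_rel3 (R : nat -> nat -> nat -> Prop) s t u :
  ndef (fun v => R (v 0) (v 1) (v 2)) -> tdef s -> tdef t -> tdef u ->
  ndef (fun v => R (s v) (t v) (u v)).
Proof.
move=> dR ds dt du; apply: (ndef_subst (Q := fun n v => R n (t v) (u v)) _ ds).
apply: (ndef_subst (Q := fun n v => R (v 0) n (u (fun i => v i.+1))) _ (tdef_ren _ dt)).
apply: (ndef_subst (Q := fun n v => R (v 1) (v 0) n) _ (tdef_ren (fun i => i.+2) du)).
exact: (definable_ren (fun i => 2 - i) dR).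
Qed.

Lemma tdef_var x : tdef (fun v => v x).
Proof. by apply: (ndef_ydef (ydef_eq x.+1 0)) => v; split=> [/num_inj|->]. Qed.
#[local] Hint Resolve tdef_var : def.

Lemma ndef_eq t u : tdef t -> tdef u -> ndef (fun v => t v = u v).
Proof.
by apply: ndef_rel2; apply: (ndef_ydef (ydef_eq 0 1)) => v; split=> [/num_inj|->].
Qed.

Lemma ndef_leq t u : tdef t -> tdef u -> ndef (fun v => t v <= u v).
Proof.
apply: (ndef_rel2 (R := fun x y => x <= y)).
by apply: (ndef_ydef (ydef_Yle 0 1)) => v; rewrite num_num.
Qed.
#[local] Hint Resolve ndef_eq ndef_leq : def.

Lemma tdef_app1 (f : nat -> nat) t :
  ndef (fun v => f (v 0) = v 1) -> tdef t -> tdef (fun v => f (t v)).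
Proof.
move=> df dt.
exact: (ndef_rel2 (R := fun x y => f x = y) df (tdef_ren S dt) (tdef_var 0)).
Qed.

Lemma tdef_app2 (f : nat -> nat -> nat) t u :
  ndef (fun v => f (v 0) (v 1) = v 2) -> tdef t -> tdef u -> tdef (fun v => f (t v) (u v)).
Proof.
move=> df dt du.
exact: (ndef_rel3 (R := fun x y z => f x y = z) df
  (tdef_ren S dt) (tdef_ren S du) (tdef_var 0)).
Qed.

Lemma tdef_add t u : tdef t -> tdef u -> tdef (fun v => t v + u v).
Proof.
by apply: tdef_app2; apply: (ndef_ydef (ydef_plus_is 0 1 2)) => v; rewrite plus_isP.
Qed.
#[local] Hint Resolve tdef_add : def.

Lemma tdef_succ t : tdef t -> tdef (fun v => (t v).+1).
Proof.
apply: tdef_app1; apply: (definable_ext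
  (Q := fun v => ~ v 1 <= v 0 /\ forall z, ~ z <= v 0 -> v 1 <= z)); last by define.
move=> v; split=> [<-|[v01 /(_ (v 0).+1)]]; [by split=> [|z]; lia|lia].
Qed.
#[local] Hint Resolve tdef_succ : def.

Lemma tdef_const n : tdef (fun _ => n).
Proof.
elim: n => [|n IHn]; last exact: (tdef_succ IHn).
apply: (definable_ext (Q := fun v => v 0 + v 0 = v 0)); last by define.
by move=> v; lia.
Qed.
#[local] Hint Resolve tdef_const : def.

(** A finite set in which every element is initial or has a [B]-predecessor in the set. This
    replaces a definition by recursion with one quantifier over partitions. *)
Definition chain (A : nat -> Prop) (B : nat -> nat -> Prop) (z : nat) :=
  exists p, memY p (num z) /\
    forall u, memY p (num u) -> A u \/ exists w, memY p (num w) /\ B u w.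

Lemma chainI (X : nat -> bool) N A B z : z < N -> X z ->
  (forall u, u < N -> X u -> A u \/ exists w, [/\ w < N, X w & B u w]) -> chain A B z.
Proof.
move=> zN Xz H; have [p pE] := memY_fin X N; exists p; rewrite pE zN Xz.
split=> // u /pE/andP[uN Xu]; case: (H u uN Xu) => [Au|[w [wN Xw Bw]]]; first by left.
by right; exists w; rewrite pE wN.
Qed.

(** Predecessors lower the measure [mu], so going back through the set must end in [A]. *)
Lemma chain_ind (mu : nat -> nat) (A : nat -> Prop) B (P : nat -> Prop) z :
  (forall u, A u -> P u) -> (forall u w, B u w -> mu w < mu u /\ (P w -> P u)) ->
  chain A B z -> P z.
Proof.
move=> AP BP [p [pz H]]; have [n] := ubnP (mu z).
elim: n z pz => // n IHn z pz zn.
case: (H z pz) => [/AP//|[w [pw /BP[wz]]]]; apply; apply: IHn => //.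
exact: leq_trans wz zn.
Qed.

Lemma ydef_Ysat (q : form) (f : (nat -> partition) -> nat -> partition) r : base q ->
  (forall e i, f e i = e (r i)) -> ydef (fun e => Ysat (f e) q).
Proof.
move=> bq fr; apply: (definable_ext (Q := fun e => Ysat (fun i => e (r i)) q)).
  by move=> e; apply: sat_ext => i; rewrite fr.
by exists (ren r q) => [|e]; rewrite ?base_ren // sat_ren.
Qed.

(** The set variable ranges over all partitions and not just staircases, so the formula is built
    over partitions, with the number variables guarded by [stair]. *)
Lemma ndef_chain (A : (nat -> nat) -> nat -> Prop) B t :
  ndef (fun v => A (fun i => v i.+1) (v 0)) ->
  ndef (fun v => B (fun i => v i.+2) (v 1) (v 0)) ->
  tdef t -> ndef (fun v => chain (A v) (B v) (t v)).
Proof.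
move=> [a ba Ha] [b bb Hb]; apply: (ndef_subst (Q := fun z v => chain (A v) (B v) z)).
pose tl (e : nat -> partition) i := e i.+1.
apply: (@ndef_ydef (fun e => exists p, memY p (e 0) /\ forall u, stair u -> memY p u ->
    Ysat (scons u (tl e)) a \/
    exists w, stair w /\ memY p w /\ Ysat (scons w (scons u (tl e))) b)).
  define.
  - by apply: (@ydef_Ysat _ _ (fun i => if i is j.+1 then j.+3 else 0)) => // e [].
  - apply: (@ydef_Ysat _ _ (fun i =>
      if i is j.+1 then (if j is k.+1 then k.+4 else 1) else 0)) => //.
    by move=> e [|[]].
move=> v.
have EA n : Ysat (scons (num n) (tl (fun i => num (v i)))) a <-> A (fun i => v i.+1) n.
  by rewrite -(Ha (scons n (fun i => v i.+1))); apply: sat_ext => -[].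
have EB n m : Ysat (scons (num m) (scons (num n) (tl (fun i => num (v i))))) b <->
    B (fun i => v i.+1) n m.
  by rewrite -(Hb (scons m (scons n (fun i => v i.+1)))); apply: sat_ext => -[|[]].
split=> -[p [p0 H]]; exists p; split=> //; [move=> u pu|move=> _ /stairP[u ->] pu].
  case: (H _ (stair_num u) pu) => [/EA|[_ [/stairP[w ->] [pw /EB]]]]; [by left|].
  by right; exists w.
case: (H u pu) => [/EA|[w [pw /EB]]]; [by left|].
by right; exists (num w); split => //; apply: stair_num.
Qed.

(** The chain subtracts the divisor until it reaches 0; positivity of the divisor makes it
    descend. *)
Lemma ndef_dvdn t u : tdef t -> tdef u -> ndef (fun v => 0 < t v /\ t v %| u v).
Proof.
apply: (ndef_rel2 (R := fun x z => 0 < x /\ x %| z)).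
apply: (definable_ext (Q := fun v =>
  0 < v 0 /\ chain (fun u => u = 0) (fun u w => u = w + v 0) (v 1))); last first.
  by define; apply: ndef_chain; define.
move=> v; move: (v 0) (v 1) => x z; split=> -[x0 H]; split=> //; last first.
  apply: (chain_ind (mu := id) (P := fun u => x %| u) _ _ H) => [_ ->|y w ->].
    exact: dvdn0.
  by split=> [|xw]; [lia|rewrite dvdn_addl].
apply: (chainI (X := fun y => x %| y) (ltnSn z) H) => y yz xy.
have [->|y0] := posnP y; [by left|right].
have xley : x <= y by apply: dvdn_leq.
by exists (y - x); split; [lia|rewrite dvdn_subr|rewrite subnK].
Qed.
#[local] Hint Resolve ndef_dvdn : def.

(** For s > 0 the product s(s+1) is the least positive common multiple of the coprime numbers s and
    s+1, so divisibility and order define it. *)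
Lemma tdef_mulS t : tdef t -> tdef (fun v => t v * (t v).+1).
Proof.
apply: (tdef_app1 (f := fun s => s * s.+1)); apply: (definable_ext (Q := fun v =>
  (v 0 = 0 /\ v 1 = 0) \/
  (0 < v 0 /\ v 0 %| v 1) /\ (0 < (v 0).+1 /\ (v 0).+1 %| v 1) /\ 0 < v 1 /\
     (forall z, (0 < z) /\ (0 < v 0 /\ v 0 %| z) /\ (0 < (v 0).+1 /\ (v 0).+1 %| z) ->
      v 1 <= z))); last by define.
move=> v; move: (v 0) (v 1) => s y.
have dvd z : s %| z -> s.+1 %| z -> s * s.+1 %| z by rewrite Gauss_dvd ?coprimenS // => -> ->.
split=> [<-|[[-> ->]//|[[s0 sy] [[_ Sy] [y0 ymin]]]]]; last first.
  apply/eqP; rewrite eqn_leq (dvdn_leq y0 (dvd y sy Sy)) ymin //.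
  by rewrite muln_gt0 s0 dvdn_mulr // dvdn_mull.
have [->|s0] := posnP s; [by left|right].
rewrite muln_gt0 s0 dvdn_mulr // dvdn_mull //; do 7?split=> //.
by move=> z [z0 [[_ sz] [_ Sz]]]; apply: dvdn_leq => //; apply: dvd.
Qed.
#[local] Hint Resolve tdef_mulS : def.

Lemma tdef_half t : tdef t -> tdef (fun v => (t v)./2).
Proof.
apply: tdef_app1; apply: (definable_ext
  (Q := fun v => v 0 = v 1 + v 1 \/ v 0 = (v 1 + v 1).+1)); last by define.
by move=> v; lia.
Qed.
#[local] Hint Resolve tdef_half : def.

Lemma ndef_odd t : tdef t -> ndef (fun v => odd (t v)).
Proof.
apply: (ndef_rel1 (R := fun x => odd x)).
apply: (definable_ext (Q := fun v => exists y, v 0 = (y + y).+1)).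
  by move=> v; split=> [ot|[y ->]]; [exists (v 0)./2; lia|lia].
by define.
Qed.

Lemma tdef_cpair t u : tdef t -> tdef u -> tdef (fun v => cpair (t v) (u v)).
Proof.
by move=> dt du; apply: tdef_add => //; apply: tdef_half; apply: tdef_mulS; apply: tdef_add.
Qed.
#[local] Hint Resolve ndef_odd tdef_cpair : def.

(** * Codes of pairs, finite sets and lists *)

Definition tri s := (s * s.+1)./2.

Lemma cpairE x y : cpair x y = tri (x + y) + y. Proof. by []. Qed.

Lemma triS s : tri s.+1 = tri s + s.+1.
Proof.
rewrite /tri; have -> : s.+1 * s.+2 = s * s.+1 + s.+1.*2 by lia.
by rewrite halfD odd_double andbF doubleK.
Qed.

Lemma tri_lt s s' : s < s' -> tri s + s < tri s'.
Proof.
by move=> /subnK <-; elim: (s' - s.+1) => [|k]; rewrite ?add0n ?addSn triS; lia.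
Qed.

(** Codes on distinct antidiagonals lie in disjoint intervals, which start at the triangular
    numbers. *)
Lemma cpair_inj x y x' y' : cpair x y = cpair x' y' -> x = x' /\ y = y'.
Proof.
rewrite !cpairE; case: (ltngtP (x + y) (x' + y')) => [/tri_lt|/tri_lt|E]; rewrite ?E; lia.
Qed.

Lemma leq_cpair x y : x + y <= cpair x y.
Proof.
rewrite cpairE; apply: leq_trans (leq_addr y _).
by elim: (x + y) => // s IHs; rewrite triS; lia.
Qed.

Lemma cpair_surj n : exists xy : nat * nat, cpair xy.1 xy.2 == n.
Proof.
elim: n => [|n [[[|x] y] /eqP <-]]; first by exists (0, 0).
  by exists (y.+1, 0); rewrite /= !cpairE add0n !addn0 triS; lia.
by exists (x, y.+1); rewrite /= !cpairE addSn !addnS.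
Qed.

Definition unpair n : nat * nat := xchoose (cpair_surj n).

Arguments unpair : simpl never.

Lemma unpairK n : cpair (unpair n).1 (unpair n).2 = n.
Proof. exact/eqP/(xchooseP (cpair_surj n)). Qed.

Lemma cpairK x y : unpair (cpair x y) = (x, y).
Proof. by have /cpair_inj[] := unpairK (cpair x y); case: unpair => a b /= -> ->. Qed.

Section Iter.
Variable g : nat -> nat.
Hypothesis dg : forall t, tdef t -> tdef (fun v => g (t v)).

(** The chain consists of the pairs of an index and the iterate at that index; the index is the
    decreasing measure. *)
Lemma tdef_iter t u : tdef t -> tdef u -> tdef (fun v => iter (t v) g (u v)).
Proof.
apply: (tdef_app2 (f := fun n x => iter n g x)); apply: (definable_ext (Q := fun v =>
  chain (fun z => z = cpair 0 (v 1))
    (fun z w => exists i, exists s, w = cpair i s /\ z = cpair i.+1 (g s))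
    (cpair (v 0) (v 2)))); last first.
  by apply: ndef_chain; define.
move=> v; move: (v 0) (v 1) (v 2) => n x y; split=> [<-|H].
  pose X z := ((unpair z).1 <= n) && ((unpair z).2 == iter (unpair z).1 g x).
  (* The iterates need not be monotone, so the set is bounded by the maximum over all its pairs. *)
  pose N := \max_(i < n.+1) (cpair i (iter i g x)).+1.
  have XN i : i <= n -> cpair i (iter i g x) < N.
    by move=> le_in; apply: (leq_bigmax (Ordinal (le_in : i < n.+1))).
  apply: (chainI (X := X) (N := N)) => [||z _]; first exact: XN.
    by rewrite /X cpairK leqnn /=.
  rewrite /X; case: (unpair z) (unpairK z) => i s /= <- /andP[le_in /eqP ->].
  case: i le_in => [|i] le_in; first by left.
  right; exists (cpair i (iter i g x)); rewrite cpairK (ltnW le_in) /= eqxx.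
  by split=> //; [apply/XN/ltnW|exists i, (iter i g x)].
suff: (unpair (cpair n y)).2 = iter (unpair (cpair n y)).1 g x by rewrite cpairK.
apply: (chain_ind (mu := fun z => (unpair z).1)
  (P := fun z => (unpair z).2 = iter (unpair z).1 g x) _ _ H) => [_ ->|_ _ [i [s [-> ->]]]].
  by rewrite cpairK.
by rewrite !cpairK /=; split=> // ->.
Qed.
End Iter.

(** Through its binary digits a number codes a finite set, so finite sets can now be quantified as
    numbers. *)
Definition bits c i := odd (iter i half c).

Lemma bits_ex (X : nat -> bool) N : exists c, forall i, bits c i = (i < N) && X i.
Proof.
elim: N X => [|N IHN] X.
  by exists 0 => i; rewrite /bits (_ : iter i half 0 = 0) //; elim: i => //= i ->.
have [c Hc] := IHN (fun i => X i.+1).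
exists (X 0 + c.*2) => -[|i]; first by rewrite /bits /= oddD odd_double addbF oddb.
by rewrite ltnS -(Hc i) /bits iterSr half_bit_double.
Qed.

Lemma ndef_bits t u : tdef t -> tdef u -> ndef (fun v => bits (t v) (u v)).
Proof. by move=> dt du; apply/ndef_odd/tdef_iter => // w; apply: tdef_half. Qed.
#[local] Hint Resolve ndef_bits : def.

(** These are the list operations on the codes of [code_list]. Every number codes a list, read as 0
    past its end, so every number can serve as an environment. *)
Definition consc k l := (cpair k l).+1.
Definition hdc n := if n is m.+1 then (unpair m).1 else 0.
Definition tlc n := if n is m.+1 then (unpair m).2 else 0.
Definition dropc i l := iter i tlc l.
Definition nthc l i := hdc (dropc i l).

Lemma hd_consc k l : hdc (consc k l) = k. Proof. by rewrite /= cpairK. Qed.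
Lemma tl_consc k l : tlc (consc k l) = l. Proof. by rewrite /= cpairK. Qed.
Lemma nth_consc0 k l : nthc (consc k l) 0 = k. Proof. exact: hd_consc. Qed.
Lemma nth_consc k l i : nthc (consc k l) i.+1 = nthc l i.
Proof. by rewrite /nthc /dropc iterSr tl_consc. Qed.

(** This makes the recursive choice of Henkin witnesses well founded. *)
Lemma nthc_leq l i : nthc l i <= l.
Proof.
have tl_leq m : tlc m <= m.
  by case: m => //= m; have := leq_cpair (unpair m).1 (unpair m).2; rewrite unpairK; lia.
have hd_leq m : hdc m <= m.
  by case: m => //= m; have := leq_cpair (unpair m).1 (unpair m).2; rewrite unpairK; lia.
by apply: leq_trans (hd_leq _) _; elim: i => //= i; apply: leq_trans.
Qed.

Lemma dropc0 i : dropc i 0 = 0.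
Proof. by rewrite /dropc; elim: i => //= i ->. Qed.

Lemma nthc_code l i : nthc (code_list l) i = nth 0 l i.
Proof.
elim: l i => [|x l IHl] i; first by rewrite /nthc dropc0 nth_nil.
by case: i => [|i]; [apply: nth_consc0|rewrite (nth_consc x) IHl].
Qed.

Lemma dropc_code l i : dropc i (code_list l) = code_list (drop i l).
Proof.
elim: l i => [|x l IHl] i; first exact: dropc0.
case: i => // i; rewrite [drop _ _]/= -IHl /dropc iterSr.
by rewrite (tl_consc x (code_list l)).
Qed.

(** Expresses the length of a coded list through a definable function. *)
Lemma dropc_code_eq0 l i : dropc i (code_list l) = 0 <-> size l <= i.
Proof.
rewrite dropc_code -subn_eq0 -size_drop.
by case: (drop i l) => [|x s]; split.
Qed.

Lemma code_list_inj : injective code_list.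
Proof.
elim=> [|x l IHl] [|y k] //= /succn_inj/cpair_inj[-> /IHl ->] //.
Qed.

Lemma code_list_surj n : exists l, code_list l == n.
Proof.
have [m] := ubnP n; elim: m n => // m IHm [|n] nm; first by exists [::].
have [|l /eqP lE] := IHm (unpair n).2.
  by have := leq_cpair (unpair n).1 (unpair n).2; rewrite unpairK; lia.
by exists ((unpair n).1 :: l); rewrite /= lE unpairK.
Qed.

Definition decl n := xchoose (code_list_surj n).
Lemma declK n : code_list (decl n) = n. Proof. exact/eqP/(xchooseP (code_list_surj n)). Qed.

Lemma tdef_consc t u : tdef t -> tdef u -> tdef (fun v => consc (t v) (u v)).
Proof. by move=> dt du; apply/tdef_succ/tdef_cpair. Qed.

Lemma tdef_hdc t : tdef t -> tdef (fun v => hdc (t v)).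
Proof.
apply: tdef_app1; apply: (definable_ext (Q := fun v =>
  (v 0 = 0 /\ v 1 = 0) \/ exists y, v 0 = (cpair (v 1) y).+1)); last by define.
move=> v; case: (v 0) (v 1) => [|n] x /=.
  by split=> [<-|[[_ ->]//|[]//]]; left.
split=> [<-|[[]//|[y [->]]]]; last by rewrite cpairK.
by right; exists (unpair n).2; rewrite unpairK.
Qed.

Lemma tdef_tlc t : tdef t -> tdef (fun v => tlc (t v)).
Proof.
apply: tdef_app1; apply: (definable_ext (Q := fun v =>
  (v 0 = 0 /\ v 1 = 0) \/ exists y, v 0 = (cpair y (v 1)).+1)); last by define.
move=> v; case: (v 0) (v 1) => [|n] x /=.
  by split=> [<-|[[_ ->]//|[]//]]; left.
split=> [<-|[[]//|[y [->]]]]; last by rewrite cpairK.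
by right; exists (unpair n).1; rewrite unpairK.
Qed.
#[local] Hint Resolve tdef_consc tdef_hdc tdef_tlc : def.

Lemma tdef_dropc t u : tdef t -> tdef u -> tdef (fun v => dropc (t v) (u v)).
Proof. by move=> dt du; apply: tdef_iter => // w; apply: tdef_tlc. Qed.
#[local] Hint Resolve tdef_dropc : def.

Lemma tdef_nthc t u : tdef t -> tdef u -> tdef (fun v => nthc (t v) (u v)).
Proof. by move=> dt du; apply/tdef_hdc/tdef_dropc. Qed.
#[local] Hint Resolve tdef_nthc : def.

(** * Recursive functions are definable *)

Fixpoint prf_nested_ind (P : prf -> Prop) (P0 : P PZero) (PS : P PSucc)
    (Pproj : forall i, P (PProj i))
    (Pcomp : forall f gs, P f -> foldr (fun g => and (P g)) True gs -> P (PComp f gs))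
    (Pprec : forall f g, P f -> P g -> P (PPrec f g))
    (Pmin : forall f, P f -> P (PMin f)) (f : prf) : P f :=
  let IH := prf_nested_ind P0 PS Pproj Pcomp Pprec Pmin in
  match f with
  | PZero => P0
  | PSucc => PS
  | PProj i => Pproj i
  | PComp f gs => Pcomp f gs (IH f)
      ((fix all gs := match gs return foldr (fun g => and (P g)) True gs with
        | [::] => Logic.I
        | g :: gs => conj (IH g) (all gs)
        end) gs)
  | PPrec f g => Pprec f g (IH f) (IH g)
  | PMin f => Pmin f (IH f)
  end.

Lemma eval_zeroP v r : eval PZero v r <-> r = 0.
Proof. by split=> [H|->]; [inversion H|constructor]. Qed.

Lemma eval_succP v r : eval PSucc v r <-> r = (nth 0 v 0).+1.
Proof. by split=> [H|->]; [inversion H|constructor]. Qed.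

Lemma eval_projP i v r : eval (PProj i) v r <-> r = nth 0 v i.
Proof. by split=> [H|->]; [inversion H|constructor]. Qed.

Lemma eval_compP f gs v r :
  eval (PComp f gs) v r <-> exists ws, evals gs v ws /\ eval f ws r.
Proof.
split=> [H|[ws [Hg Hf]]]; last exact: ev_comp Hg Hf.
by inversion H; subst; exists ws.
Qed.

Lemma evals_nilP v ws : evals [::] v ws <-> ws = [::].
Proof. by split=> [H|->]; [inversion H|constructor]. Qed.

Lemma evals_consP g gs v ws :
  evals (g :: gs) v ws <-> exists w ws', ws = w :: ws' /\ eval g v w /\ evals gs v ws'.
Proof.
split=> [H|[w [ws' [-> [Hg Hgs]]]]]; last by constructor.
by inversion H; subst; exists w, ws0.
Qed.

Lemma eval_prec_nil f g r : ~ eval (PPrec f g) [::] r.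
Proof. by move=> H; inversion H. Qed.

Lemma eval_prec0P f g v r : eval (PPrec f g) (0 :: v) r <-> eval f v r.
Proof. by split=> [H|]; [inversion H|constructor]. Qed.

Lemma eval_precSP f g n v r : eval (PPrec f g) (n.+1 :: v) r <->
  exists s, eval (PPrec f g) (n :: v) s /\ eval g [:: n, s & v] r.
Proof.
split=> [H|[s [Hs Hg]]]; last exact: ev_precS Hs Hg.
by inversion H; subst; exists r0.
Qed.

Lemma eval_minP f v n : eval (PMin f) v n <-> eval f (n :: v) 0 /\
  forall m, m < n -> exists k, 0 < k /\ eval f (m :: v) k.
Proof. by split=> [H|[H0 H]]; [inversion H|constructor]. Qed.

Lemma eval_det f v r r' : eval f v r -> eval f v r' -> r = r'.
Proof.
elim/prf_nested_ind: f v r r' => [||i|f gs IHf IHgs|f g IHf IHg|f IHf] v r r'.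
- by rewrite !eval_zeroP => -> ->.
- by rewrite !eval_succP => -> ->.
- by rewrite !eval_projP => -> ->.
- rewrite !eval_compP => -[ws [Hws Hr]] [ws' [Hws' Hr']].
  suff E : ws = ws' by apply: IHf Hr _; rewrite E.
  elim: gs IHgs ws ws' {Hr Hr'} Hws Hws' => [_|g gs IH /= [IHg IHgs]] ws ws'.
    by rewrite !evals_nilP => -> ->.
  rewrite !evals_consP => -[w [ws1 [-> [Hw Hws]]]] [w' [ws1' [-> [Hw' Hws']]]].
  by rewrite (IHg _ _ _ Hw Hw') (IH IHgs _ _ Hws Hws').
- case: v => [/eval_prec_nil//|n v].
  elim: n r r' => [|n IHn] r r'; first by rewrite !eval_prec0P; apply: IHf.
  rewrite !eval_precSP => -[s [Hs Hr]] [s' [Hs' Hr']].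
  by rewrite (IHn _ _ Hs Hs') in Hr; apply: IHg Hr Hr'.
- rewrite !eval_minP => -[r0 Hr] [r0' Hr'].
  case: (ltngtP r r') => // [/Hr'|/Hr] [k [k0 Hk]].
    by rewrite (IHf _ _ _ r0 Hk) ltnn in k0.
  by rewrite (IHf _ _ _ r0' Hk) ltnn in k0.
Qed.

(** The digits of [c] record the history of the recursion. Conversely, in any set whose members are
    each justified by a member of the previous index, all members are correct values. *)
Lemma eval_precP f g n v r : eval (PPrec f g) (n :: v) r <->
  exists c, bits c (cpair n r) /\ forall i s, bits c (cpair i s) ->
    (i = 0 /\ eval f v s) \/
    exists j s', i = j.+1 /\ bits c (cpair j s') /\ eval g [:: j, s' & v] s.
Proof.
split=> [H|[c [cn H]]]; last first.
  elim: n r cn => [|n IHn] r /H[[//]|[j [s [//]]]].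
    by move=> _ /eval_prec0P.
  by move=> [<-] [cs Hg]; apply/eval_precSP; exists s; split=> //; apply: IHn.
have ex i : i <= n -> exists s, eval (PPrec f g) (i :: v) s.
  move=> /subnKC E; move: H; rewrite -E; elim: (n - i) r => [|k IHk] r.
    by rewrite addn0; exists r.
  by rewrite addnS => /eval_precSP[s [Hs _]]; apply: IHk Hs.
(* By determinism there is one value per index, hence finitely many pairs to bound. *)
have [N HN] : exists N, forall i s, i <= n -> eval (PPrec f g) (i :: v) s -> cpair i s < N.
  elim: n {H} ex => [|n IHn] ex.
    have [s Hs] := ex 0 (leqnn 0); exists (cpair 0 s).+1 => -[|i] s' // _ Hs'.
    by rewrite (eval_det Hs Hs').
  have [N HN] := IHn (fun i le_in => ex i (leqW le_in)).
  have [s Hs] := ex n.+1 (leqnn _); exists (maxn N (cpair n.+1 s).+1) => i s'.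
  rewrite leq_eqVlt => /orP[/eqP->|le_in] Hs'.
    by rewrite (eval_det Hs Hs') leq_maxr.
  by apply: leq_trans (HN _ _ le_in Hs') (leq_maxl _ _).
pose X z : bool := excluded_middle_informative ((unpair z).1 <= n /\
  eval (PPrec f g) ((unpair z).1 :: v) (unpair z).2).
have [c cE] := bits_ex X N.
have cXE i s : bits c (cpair i s) <-> i <= n /\ eval (PPrec f g) (i :: v) s.
  rewrite cE /X cpairK /=; case: excluded_middle_informative => /= H1; last by rewrite andbF.
  by rewrite andbT; split=> // _; case: H1 => le_in; apply: HN.
exists c; rewrite cXE; split=> // -[|i] s /cXE[le_in].
  by move=> /eval_prec0P; left.
move=> /eval_precSP[s' [Hs' Hg]]; right; exists i, s'; split=> //; split=> //.
by apply/cXE; split=> //; apply: ltnW.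
Qed.

Lemma ndef_eval f xs y : ndef (fun v => eval f [seq v i | i <- xs] (v y)).
Proof.
elim/prf_nested_ind: f xs y => [||i|f gs IHf IHgs|f g IHf IHg|f IHf] xs y.
- by apply: (definable_ext (fun v => eval_zeroP _ _)); define.
- apply: (definable_ext (fun v => eval_succP _ _)).
  by case: xs => [|x xs] /=; define.
- apply: (definable_ext (fun v => eval_projP _ _ _)).
  have [ix|ix] := ltnP i (size xs).
    apply: (definable_ext (Q := fun v => v y = v (nth 0 xs i))); last by define.
    by move=> v; rewrite (nth_map 0).
  apply: (definable_ext (Q := fun v => v y = 0)); last by define.
  by move=> v; rewrite nth_default ?size_map.
- apply: (definable_ext (fun v => eval_compP _ _ _ _)).
  (* The entries of [ws] are quantified one at a time; [zs] collects the variables of those already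
     obtained. *)
  have : forall zs, ndef (fun v => exists ws,
      evals gs [seq v i | i <- xs] ws /\ eval f ([seq v i | i <- zs] ++ ws) (v y)).
    elim: gs IHgs xs y => [_|g gs IH /= [IHg IHgs]] xs y zs.
      apply: definable_ext (IHf zs y) => v; split=> [[_ [/evals_nilP->]]|].
        by rewrite cats0.
      by exists [::]; rewrite evals_nilP cats0.
    apply: (definable_ext (Q := fun v => exists w, eval g [seq v i | i <- xs] w /\
      exists ws, evals gs [seq v i | i <- xs] ws /\
        eval f (rcons [seq v i | i <- zs] w ++ ws) (v y))).
      move=> v; split=> [[_ [/evals_consP[w [ws [-> [Hw Hws]]]] Hf]]|].
        by exists w; split=> //; exists ws; rewrite cat_rcons.
      move=> [w [Hw [ws [Hws Hf]]]]; exists (w :: ws); rewrite -cat_rcons.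
      by split=> //; apply/evals_consP; exists w, ws.
    apply: (definable_ex range_num); apply: definable_and.
      apply: definable_ext (IHg (map S xs) 0) => v; by rewrite -map_comp.
    apply: definable_ext (IH IHgs (map S xs) y.+1 (rcons (map S zs) 0)) => v.
    by rewrite map_rcons -!map_comp.
  by move/(_ [::]).
- case: xs => [|x xs].
    by apply: definable_ext (definable_False num) => v; split=> // /eval_prec_nil.
  apply: (definable_ext (fun v => eval_precP f g (v x) [seq v i | i <- xs] (v y))); define.
    (* Here [s], [i], [c] are the variables 0, 1, 2; in the next goal [s'] and [j] come in as 0 and
       1 and move them to 2, 3, 4. *)
    by apply: definable_ext (IHf (map (addn 3) xs) 0) => v; rewrite -map_comp.
  by apply: definable_ext (IHg [:: 1, 0 & map (addn 5) xs] 2) => v; rewrite /= -map_comp.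
- apply: (definable_ext (fun v => eval_minP _ _ _)); define.
    apply: (definable_ext (Q := fun v => exists z, z = 0 /\
      eval f (v y :: [seq v i | i <- xs]) z)).
      by move=> v; split=> [H|[_ [->]]] //; exists 0.
    define.
    by apply: definable_ext (IHf (map S (y :: xs)) 0) => v; rewrite /= -map_comp.
  by apply: definable_ext (IHf (1 :: map (addn 2) xs) 0) => v; rewrite /= -map_comp.
Qed.

(** * Undefinability of truth *)

Lemma code_inj : injective code.
Proof.
elim=> [x y|x y|r a||p IHp q IHq|p IHp] [x' y'|x' y'|r' a'||p' q'|p'] //= /cpair_inj[] // _.
- by move=> /cpair_inj[-> ->].
- by move=> /cpair_inj[-> ->].
- by move=> /cpair_inj[-> /code_list_inj ->].
- by move=> /cpair_inj[/IHp -> /IHq ->].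
- by move=> /IHp ->.
Qed.

(** Renaming every variable to its minimum with [k] bounds the free variables without any analysis
    of the formula. *)
Lemma ydef_bound k P : ydef P -> (forall e, P e <-> P (fun i => e (minn i k))) ->
  exists p, [/\ base p, bound k.+1 p & forall e, Ysat e p <-> P e].
Proof.
move=> [p bp Hp] Pk; exists (ren (fun i => minn i k) p); split=> [||e].
- by rewrite base_ren.
- by apply: bound_ren => i; rewrite ltnS geq_minr.
- by rewrite sat_ren Pk Hp.
Qed.

Lemma zero_form : exists p, [/\ base p, bound 1 p & forall e, Ysat e p <-> e 0 = num 0].
Proof.
apply: (@ydef_bound 0 (fun e => e 0 = num 0)) => //.
apply: (definable_ext 
  (Q := fun e => stair (e 0) /\ forall y, stair y -> Yle (e 0) y)); last by define.
move=> e; split=> [->|[/stairP[n ->] /(_ _ (stair_num 0))/num_num]].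
  by split=> [|_ /stairP[n ->]]; [apply: stair_num|apply/num_num].
by rewrite leqn0 => /eqP->.
Qed.

Lemma succ_form : exists p, [/\ base p, bound 2 p &
  forall e, Ysat e p <-> exists n, e 0 = num n /\ e 1 = num n.+1].
Proof.
apply: (@ydef_bound 1 (fun e => exists n, e 0 = num n /\ e 1 = num n.+1)) => //.
apply: (definable_ext (Q := fun e => stair (e 0) /\ stair (e 1) /\ Ylt (e 0) (e 1) /\
  forall z, stair z -> Ylt (e 0) z -> Yle (e 1) z)); last by define.
rewrite /Ylt => e; split=> [[n [-> ->]]|[/stairP[n ->] [/stairP[m ->]]]].
  split; first exact: stair_num.
  split; first exact: stair_num.
  split; first by rewrite !num_num; lia.
  by move=> _ /stairP[m ->]; rewrite !num_num; lia.
rewrite !num_num => -[nm /(_ _ (stair_num n.+1))]; rewrite !num_num => mn.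
by exists n; split=> //; congr num; lia.
Qed.

(* The diagonal sentence of a formula [q] with code [m] is "for all x, if x is
   the numeral m then q(x)", so that its code is a definable function of m. *)
Lemma tarski (P : nat -> Prop) : ndef (fun v => P (v 0)) ->
  ~ forall p, base p -> sentence p -> (P (code p) <-> Young_sat p).
Proof.
move=> dP HP.
have [z [bz nz Hz]] := zero_form; have [s [bs ns Hs]] := succ_form.
(* [numeral n] says that variable 0 is [num n]. The previous numeral is satisfied by exactly one
   value, so the universal quantifier also acts as an existential one. *)
pose numeral n := iter n (fun p => Fall (Fimp p s)) z.
have numeralP n e : Ysat e (numeral n) <-> e 0 = num n.
  elim: n e => [|n IHn] e; first exact: Hz.
  change (Ysat e (numeral n.+1)) with
    (forall d, Ysat (scons d e) (numeral n) -> Ysat (scons d e) s).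
  split=> [/(_ (num n))|E d]; rewrite IHn Hs /=.
    by move=> /(_ erefl)[m [/num_inj <-]].
  by move=> ->; exists n.
have base_num n : base (numeral n) by elim: n => //= n ->.
have bound_num n : bound 1 (numeral n).
  by elim: n => //= n IHn; rewrite ns andbT; apply: bound_leq IHn.
pose step c := cpair 5 (cpair 4 (cpair c (code s))).
pose diag m := cpair 5 (cpair 4 (cpair (iter m step (code z)) m)).
have dstep t : tdef t -> tdef (fun v => step (t v)) by rewrite /step; auto with def.
have ddiag : tdef (fun v => diag (v 0)).
  rewrite /diag; do 2!(apply: tdef_cpair; first exact: tdef_const).
  apply: tdef_cpair (tdef_var 0); apply: tdef_iter => //; auto with def.
have code_numeral n : code (numeral n) = iter n step (code z) by elim: n => //= n ->.
clearbody numeral.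
have [q0 bq0 Hq0] := definable_not (ndef_rel1 dP ddiag).
(* Identifying all variables leaves only variable 0 free, so that [G] is a sentence. *)
pose q := ren (fun _ => 0) q0.
have Hq e n : e 0 = num n -> Ysat e q <-> ~ P (diag n).
  move=> e0; rewrite sat_ren -(Hq0 (fun _ => n)).
  by apply: sat_ext => i; rewrite e0.
pose G := Fall (Fimp (numeral (code q)) q).
have bG : base G by rewrite /G /= base_num /q base_ren bq0.
have sG : sentence G by rewrite /sentence /= bound_num bound_ren.
have cG : code G = diag (code q) by rewrite /G /= code_numeral.
have : Young_sat G <-> ~ P (code G).
  rewrite cG; split=> [H|nP e d /= /numeralP /= dE].
    apply/(Hq (scons (num (code q)) (fun _ => num 0)) (code q) erefl).
    by apply: (H (fun _ => num 0)); apply/numeralP.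
  exact/(Hq _ _ dE).
by have := HP G bG sG; tauto.
Qed.

Theorem ThY_undecidable : ~ decidable_form ThY.
Proof.
move=> [f Hf]; apply: (@tarski (fun n => eval f [:: n] 1)).
  apply: (definable_ext (Q := fun v => exists y, y = 1 /\ eval f [:: v 0] y)).
    by move=> v; split=> [H|[_ [->]]//]; exists 1.
  define; exact: (ndef_eval f [:: 1] 0).
move=> p bp sp; have [H1 H0] := Hf (code p); split=> [e1|Yp]; last first.
  by apply: H1; exists p.
apply: NNPP => nY; suff e0 : eval f [:: code p] 0 by have := eval_det e1 e0.
by apply: H0 => -[p' [/code_inj -> [_ [_ /nY]]]].
Qed.

(** * Semantic consequence is definable *)

(** The atom on variables 0 and 1, with t = 0 for order and t = 1 for equality, paired with the
    environment listing [i] and [j]. *)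
Definition atom2 t i j := cpair (cpair t (cpair 0 1)) (consc i (consc j 0)).
Notation eqat := (atom2 1).

(* A Hintikka set for the formula codes: [cpair a l] stands for the formula with
   code [a] in the environment listed by [l], and [(cpair a l).+1] is the Henkin
   witness of [cpair (cpair 5 a) l].  [M] replaces the positive and [P] the
   negative occurrences of the set, so that both can be guarded by a bound. *)
Definition hintikka (cs : seq nat) (p : nat) (P M : nat -> Prop) : Prop :=
  (forall a b l, P (cpair (cpair 4 (cpair a b)) l) -> P (cpair a l) -> M (cpair b l)) /\
  (forall a b l, P (cpair b l) -> M (cpair (cpair 4 (cpair a b)) l)) /\
  (forall a b l, M (cpair a l) \/ M (cpair (cpair 4 (cpair a b)) l)) /\
  (forall l, ~ P (cpair (cpair 3 0) l)) /\
  (forall a l k, P (cpair (cpair 5 a) l) -> M (cpair a (consc k l))) /\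
  (forall a l, P (cpair a (consc (cpair a l).+1 l)) -> M (cpair (cpair 5 a) l)) /\
  (forall i, M (eqat i i)) /\
  (forall i j k, P (eqat i j) -> P (eqat i k) -> M (eqat j k)) /\
  (forall t x y l x' y' l', t < 2 -> P (eqat (nthc l x) (nthc l' x')) ->
     P (eqat (nthc l y) (nthc l' y')) ->
     P (cpair (cpair t (cpair x y)) l) -> M (cpair (cpair t (cpair x' y')) l')) /\
  (forall r a a' l l',
     (forall i, (dropc i a = 0 <-> dropc i a' = 0) /\
        (~ dropc i a = 0 -> P (eqat (nthc l (nthc a i)) (nthc l' (nthc a' i))))) ->
     P (cpair (cpair 2 (cpair r a)) l) -> M (cpair (cpair 2 (cpair r a')) l')) /\
  (forall c, c \in cs -> M (cpair c 0)) /\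
  ~ P (cpair p 0).

Lemma hintikka_sub cs p (P M P' M' : nat -> Prop) :
  (forall x, P' x -> P x) -> (forall x, M x -> M' x) ->
  hintikka cs p P M -> hintikka cs p P' M'.
Proof.
move=> PP MM [H1 [H2 [H3 [H4 [H5 [H6 [H7 [H8 [H9 [H10 [H11 H12]]]]]]]]]]].
split; first by move=> a b l /PP Ha /PP Hb; exact: MM (H1 _ _ _ Ha Hb).
split; first by move=> a b l /PP Hb; apply/MM/H2.
split; first by move=> a b l; case: (H3 a b l) => /MM; [left|right].
split; first by move=> l /PP; apply: H4.
split; first by move=> a l k /PP Ha; apply/MM/H5.
split; first by move=> a l /PP Ha; apply/MM/H6.
split; first by move=> i; apply/MM/H7.
split; first by move=> i j k /PP Hj /PP Hk; exact: MM (H8 _ _ _ Hj Hk).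
split.
  move=> t x y l x' y' l' t2 /PP Hx /PP Hy /PP Ht.
  exact: MM (H9 _ _ _ _ _ _ _ t2 Hx Hy Ht).
split.
  move=> r a a' l l' Ha /PP Hr; apply: MM; apply: (H10 _ _ _ _ _ _ Hr) => i.
  by have [Ha1 Ha2] := Ha i; split=> // /Ha2/PP.
by split=> [c /H11/MM|/PP].
Qed.

(** Codes from [N] on count as absent in hypotheses and as present in conclusions, so the clauses
    constrain [V] only below [N]. *)
Definition approx cs p N (V : nat -> bool) :=
  hintikka cs p (fun x => x < N /\ V x) (fun x => x < N -> V x).

Lemma ndef_mem (cs : seq nat) t : tdef t -> ndef (fun v => t v \in cs).
Proof.
apply: (ndef_rel1 (R := fun x => x \in cs)).
elim: cs => [|c cs IHcs]; first by apply: definable_ext (definable_False num).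
apply: (definable_ext (Q := fun v => v 0 = c \/ v 0 \in cs)); last by define.
move=> v; rewrite inE; split=> [/orP[/eqP|]|[->|->]]; rewrite ?eqxx ?orbT //; by [left|right].
Qed.
#[local] Hint Resolve ndef_mem : def.

Lemma tdef_atom2 t u s : tdef t -> tdef u -> tdef (fun v => atom2 s (t v) (u v)).
Proof. by move=> dt du; rewrite /atom2; auto 10 with def. Qed.
#[local] Hint Resolve tdef_atom2 : def.

Lemma ndef_approx cs :
  ndef (fun v => forall N, exists c, approx cs (v 0) N (bits c)).
Proof. rewrite /approx /hintikka; define. Qed.

(** * Weak König's lemma and the limit of the approximations *)

Lemma weak_konig (G : nat -> (nat -> bool) -> Prop) :
  (forall N N' V, N <= N' -> G N' V -> G N V) ->
  (forall N V V', (forall x, x < N -> V x = V' x) -> G N V -> G N V') ->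
  (forall N, exists V, G N V) -> exists V, forall N, G N V.
Proof.
move=> Gmono Gloc Gex.
pose ext s := forall N, exists V, G N V /\ forall i, i < size s -> V i = nth false s i.
(* If the two one-bit extensions failed at [N] and [N'], take a member of [G (maxn N N')] that
   starts with [s]: by monotonicity it lies in both [G N] and [G N'], and its next bit refutes one
   of the failures. *)
have extS s : ext s -> exists b, ext (rcons s b).
  move=> es; apply: NNPP => nb.
  have nE b : exists N, forall V, G N V ->
      ~ forall i, i < (size s).+1 -> V i = nth false (rcons s b) i.
    apply: NNPP => nN; apply: nb; exists b => N.
    apply: NNPP => nV; apply: nN; exists N => V GV HV.
    by apply: nV; exists V; rewrite size_rcons.
  have [[N HN] [N' HN']] := (nE true, nE false).
  have [V [GV HV]] := es (maxn N N').
  have VE b : V (size s) = b -> forall i, i < (size s).+1 -> V i = nth false (rcons s b) i.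
    move=> Vb i; rewrite ltnS nth_rcons leq_eqVlt => /orP[/eqP->|lt_is].
      by rewrite ltnn eqxx.
    by rewrite lt_is HV.
  case E: (V (size s)); [apply: (HN V)|apply: (HN' V)]; try exact: VE.
    exact: Gmono (leq_maxl _ _) GV.
  exact: Gmono (leq_maxr _ _) GV.
pose next s := if excluded_middle_informative (ext (rcons s true)) then true else false.
pose pre n := iter n (fun s => rcons s (next s)) [::].
have pre_size n : size (pre n) = n by elim: n => //= n; rewrite size_rcons => ->.
have pre_ext n : ext (pre n).
  elim: n => [N|n /extS[b eb]]; first by have [V GV] := Gex N; exists V.
  rewrite /= /next; case: excluded_middle_informative => // nt.
  by case: b eb.
exists (fun i => nth false (pre i.+1) i) => N.
have [V [GV HV]] := pre_ext N N; apply: Gloc GV => x xN.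
rewrite HV ?pre_size //; elim: N xN {HV} => // N IHN.
rewrite ltnS leq_eqVlt => /orP[/eqP-> //|xN].
by rewrite -(IHN xN) /= nth_rcons pre_size xN.
Qed.

(** Each instance of a clause involves finitely many codes, so it can be read off from an
    approximation beyond their sum. *)
Lemma hintikka_lim cs p (V : nat -> bool) :
  (forall N, approx cs p N V) -> hintikka cs p V V.
Proof.
move=> H.
split.
  move=> a b l Ha Hb.
  have [H1 _] := H (cpair (cpair 4 (cpair a b)) l + cpair a l + cpair b l).+1.
  by apply: (H1 a b l); rewrite ?Ha ?Hb; try split=> //; lia.
split.
  move=> a b l Hb; have [_ [H2 _]] := H (cpair (cpair 4 (cpair a b)) l + cpair b l).+1.
  by apply: (H2 a b l); rewrite ?Hb; try split=> //; lia.
split.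
  move=> a b l; have [_ [_ [H3 _]]] := H (cpair (cpair 4 (cpair a b)) l + cpair a l).+1.
  by case: (H3 a b l) => H3'; [left|right]; apply: H3'; lia.
split.
  move=> l Hl; have [_ [_ [_ [H4 _]]]] := H (cpair (cpair 3 0) l).+1.
  by apply: (H4 l).
split.
  move=> a l k Ha; have [_ [_ [_ [_ [H5 _]]]]] :=
    H (cpair (cpair 5 a) l + cpair a (consc k l)).+1.
  by apply: (H5 a l k); rewrite ?Ha; try split=> //; lia.
split.
  move=> a l Ha; have [_ [_ [_ [_ [_ [H6 _]]]]]] :=
    H (cpair (cpair 5 a) l + cpair a (consc (cpair a l).+1 l)).+1.
  by apply: (H6 a l); rewrite ?Ha; try split=> //; lia.
split.
  move=> i; have [_ [_ [_ [_ [_ [_ [H7 _]]]]]]] := H (eqat i i).+1.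
  exact: H7.
split.
  move=> i j k Hj Hk; have [_ [_ [_ [_ [_ [_ [_ [H8 _]]]]]]]] :=
    H (eqat i j + eqat i k + eqat j k).+1.
  by apply: (H8 i j k); rewrite ?Hj ?Hk; try split=> //; lia.
split.
  move=> t x y l x' y' l' t2 Hx Hy Ht.
  have [_ [_ [_ [_ [_ [_ [_ [_ [H9 _]]]]]]]]] :=
    H (eqat (nthc l x) (nthc l' x') + eqat (nthc l y) (nthc l' y') +
       cpair (cpair t (cpair x y)) l + cpair (cpair t (cpair x' y')) l').+1.
  by apply: (H9 t x y l x' y' l'); rewrite ?Hx ?Hy ?Ht; try split=> //; lia.
split.
  move=> r a a' l l' Ha Hr.
  pose E i := eqat (nthc l (nthc a i)) (nthc l' (nthc a' i)).
  (* The congruence hypothesis ranges over all [i], but only positions within the list [a] need a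
     bound. *)
  pose B := \sum_(i < size (decl a)) E i.
  have EB i : ~ dropc i a = 0 -> E i <= B.
    rewrite -{1}(declK a) dropc_code_eq0 => /negP; rewrite -ltnNge => ia.
    by rewrite /B (bigD1 (Ordinal ia)) //= leq_addr.
  have [_ [_ [_ [_ [_ [_ [_ [_ [_ [H10 _]]]]]]]]]] :=
    H (B + cpair (cpair 2 (cpair r a)) l + cpair (cpair 2 (cpair r a')) l').+1.
  apply: (H10 r a a' l l') => [i||]; [|by split=> //; lia|by lia].
  have [Ha1 Ha2] := Ha i; split=> // ia; split; last exact: Ha2.
  by have := EB i ia; rewrite -/(E i); lia.
have HH x := H x.+1; split=> [c Hc|Hp].
  by have [_ [_ [_ [_ [_ [_ [_ [_ [_ [_ [H11 _]]]]]]]]]]] := HH (cpair c 0); apply: H11.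
have [_ [_ [_ [_ [_ [_ [_ [_ [_ [_ [_ H12]]]]]]]]]]] := HH (cpair p 0).
by apply: H12.
Qed.

(** * From a Hintikka set to a countermodel *)

Section QuotientModel.
Variables (cs : seq nat) (p : nat) (V : nat -> bool).
Hypothesis HV : hintikka cs p V V.

Definition eqV i j := V (eqat i j).

Lemma eqV_refl i : eqV i i.
Proof. by case: HV => _ [_ [_ [_ [_ [_ [H _]]]]]]; apply: H. Qed.

Lemma eqV_euclid i j k : eqV i j -> eqV i k -> eqV j k.
Proof. by case: HV => _ [_ [_ [_ [_ [_ [_ [H _]]]]]]]; apply: H. Qed.

Lemma eqV_sym i j : eqV i j -> eqV j i.
Proof. by move=> ij; apply: eqV_euclid ij (eqV_refl i). Qed.

(** The least equivalent number is a canonical representative, so equality in the quotient is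
    genuine equality, as [sat] demands. *)
Definition rep i := ex_minn (ex_intro (eqV i) i (eqV_refl i)).

Lemma eqV_rep i : eqV i (rep i).
Proof. by rewrite /rep; case: ex_minnP. Qed.

Lemma rep_eq i j : (rep i = rep j) <-> eqV i j.
Proof.
split=> [E|ij].
  by apply: (@eqV_euclid (rep i)); [apply/eqV_sym/eqV_rep|rewrite E; apply/eqV_sym/eqV_rep].
rewrite /rep; case: ex_minnP => m im mmin; case: ex_minnP => n jn nmin.
apply/eqP; rewrite eqn_leq mmin ?nmin //.
  exact: eqV_euclid ij im.
exact: eqV_euclid (eqV_sym ij) jn.
Qed.

Lemma repK i : rep (rep i) == rep i.
Proof. by apply/eqP/rep_eq/eqV_sym/eqV_rep. Qed.

Definition QD := {i : nat | rep i == i}.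
Definition cls i : QD := exist _ (rep i) (repK i).

Lemma clsK (d : QD) : cls (sval d) = d.
Proof. by apply: val_inj => /=; apply/eqP/(svalP d). Qed.

Lemma cls_eq i j : (cls i = cls j) <-> eqV i j.
Proof. by rewrite -rep_eq; split=> [[]|E] //; apply: val_inj. Qed.

Definition Qle (d d' : QD) : Prop := V (atom2 0 (sval d) (sval d')).
(** The atom lists the variables 0, 1, ... in order and the arguments form the environment; the
    congruence clause carries this over to any other list of variables. *)
Definition QI r (ds : seq QD) : Prop :=
  V (cpair (cpair 2 (cpair r (code_list (iota 0 (size ds))))) (code_list (map sval ds))).

(** The truth lemma, by induction on [f]. The congruence clauses handle atoms, and the Henkin clause
    gives truth of a universal formula from its instances. *)
Lemma sat_Q f : forall l, sat Qle QI (fun i => cls (nthc l i)) f <-> V (cpair (code f) l).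
Proof.
have [H1 [H2 [H3 [H4 [H5 [H6 [_ [_ [H9 [H10 _]]]]]]]]]] := HV.
(* The environment of [atom2] lists [i] and [j], so congruence links its variables 0 and 1 to [x]
   and [y] under [l]. *)
have at2 l t x y i j : t < 2 -> eqV (nthc l x) i -> eqV (nthc l y) j ->
    V (atom2 t i j) <-> V (cpair (cpair t (cpair x y)) l).
  move=> t2 xi yj; split; apply: H9 => //.
  - by rewrite nth_consc0; apply: eqV_sym.
  - by rewrite nth_consc nth_consc0; apply: eqV_sym.
  - by rewrite nth_consc0.
  - by rewrite nth_consc nth_consc0.
elim: f => [x y|x y|r a||f IHf g IHg|f IHf] l /=.
- by apply: at2 => //; apply: eqV_rep.
- by rewrite cls_eq; apply: at2 => //; apply: eqV_refl.
- rewrite /QI size_map -map_comp.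
  set b := map _ a.
  have bn i : i < size a -> nthc (code_list b) (nthc (code_list (iota 0 (size a))) i) =
      rep (nthc l (nthc (code_list a) i)).
    by move=> ia; rewrite !nthc_code nth_iota // add0n (nth_map 0).
  split; apply: H10 => i; rewrite !dropc_code_eq0 size_iota; split=> // /negP;
    rewrite -ltnNge => ia.
    by rewrite bn //; apply/eqV_sym/eqV_rep.
  by rewrite bn //; apply/eqV_rep.
- by split=> // /H4.
- rewrite IHf IHg; split=> [fg|fg]; last exact: H1.
  by case: (H3 (code f) (code g) l) => // /fg; apply: H2.
have E k : sat Qle QI (scons (cls k) (fun i => cls (nthc l i))) f <->
    V (cpair (code f) (consc k l)).
  by rewrite -IHf; apply: sat_ext => -[|i] /=; rewrite ?nth_consc0 ?nth_consc.
split=> [H|H d]; first by apply: H6; apply/E.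
by rewrite -(clsK d); apply/E/H5.
Qed.
End QuotientModel.

(** * From a countermodel to a Hintikka set *)

Section TermModel.
Variables (D : Type) (d0 : D) (le : D -> D -> Prop) (I : nat -> seq D -> Prop).

(** The clauses of [hintikka] range over all numbers, so decoding must be total. The fuel [k]
    suffices once it exceeds [n], as subformulas have smaller codes. *)
Fixpoint decode_rec (k n : nat) : form :=
  if k is k.+1 then
    let: (t, x) := unpair n in
    let: (y, z) := unpair x in
    match t with
    | 0 => Fle y z
    | 1 => Feq y z
    | 2 => Frel y (decl z)
    | 4 => Fimp (decode_rec k y) (decode_rec k z)
    | 5 => Fall (decode_rec k x)
    | _ => Fbot
    end
  else Fbot.

Definition decode n := decode_rec n.+1 n.

Lemma decode_recE k k' n : n < k -> n < k' -> decode_rec k n = decode_rec k' n.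
Proof.
elim: k k' n => // k IHk [//|k'] n; rewrite !ltnS /= => nk nk'.
have := leq_cpair (unpair n).1 (unpair n).2; rewrite unpairK.
case: (unpair n) => [t x] /= tx.
have := leq_cpair (unpair x).1 (unpair x).2; rewrite unpairK.
case: (unpair x) => [y z] /= yz.
case: t tx => [|[|[|[|[|[|t]]]]]] //= tx; first by rewrite !(IHk k') //; lia.
by rewrite (IHk k') //; lia.
Qed.

Lemma decodeE t x y : decode (cpair t (cpair x y)) =
  match t with
  | 0 => Fle x y
  | 1 => Feq x y
  | 2 => Frel x (decl y)
  | 4 => Fimp (decode x) (decode y)
  | 5 => Fall (decode (cpair x y))
  | _ => Fbot
  end.
Proof.
have := leq_cpair t (cpair x y); have := leq_cpair x y => xy txy.
rewrite {1}/decode /= !cpairK.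
case: t txy => [|[|[|[|[|[|t]]]]]] // txy.
  by congr Fimp; apply: decode_recE; lia.
by congr Fall; apply: decode_recE; lia.
Qed.

Lemma decodeK f : decode (code f) = f.
Proof.
elim: f => [x y|x y|r a||f IHf g IHg|f IHf] /=.
- by rewrite decodeE.
- by rewrite decodeE.
- by rewrite decodeE; congr Frel; apply: code_list_inj; rewrite declK.
- exact: (decodeE 3 0 0).
- by rewrite decodeE IHf IHg.
- by rewrite -(unpairK (code f)) decodeE unpairK IHf.
Qed.

Lemma decode_all x : decode (cpair 5 x) = Fall (decode x).
Proof. by rewrite -(unpairK x) decodeE. Qed.

(* The witness numbered [w.+1] is a counterexample, if there is one, to the
   universal formula coded by [w]; its environment mentions smaller numbers only. *)
Definition falsifies (s : nat -> D) (w : nat) (d : D) :=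
  ~ sat le I (scons d (fun i => s (nthc (unpair w).2 i))) (decode (unpair w).1).

Definition witness (s : nat -> D) (w : nat) : D :=
  epsilon (inhabits d0) (falsifies s w).

(** Course-of-values recursion: the table is final on the numbers up to [n], which are all that the
    next witness depends on. *)
Fixpoint interp_upto (n : nat) : nat -> D :=
  if n is w.+1 then fun i => if i == n then witness (interp_upto w) w else interp_upto w i
  else fun _ => d0.

Definition interp n := interp_upto n n.

Lemma interp_uptoE n i : i <= n -> interp_upto n i = interp i.
Proof.
elim: n => [|n IHn]; first by rewrite leqn0 => /eqP->.
rewrite leq_eqVlt => /orP[/eqP-> //|]; rewrite ltnS => le_in /=.
by rewrite ltn_eqF ?ltnS // IHn.
Qed.

Definition env l i := interp (nthc l i).

Lemma interpS a l : (exists d, ~ sat le I (scons d (env l)) (decode a)) ->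
  ~ sat le I (scons (interp (cpair a l).+1) (env l)) (decode a).
Proof.
move=> ex; set w := cpair a l.
have E d : falsifies (interp_upto w) w d <-> ~ sat le I (scons d (env l)) (decode a).
  rewrite /falsifies cpairK; apply/not_iff_compat/sat_ext.
  case=> //= i; apply: interp_uptoE; apply: leq_trans (nthc_leq l i) _.
  by apply: leq_trans (leq_cpair a l); apply: leq_addl.
have -> : interp w.+1 = witness (interp_upto w) w by rewrite /interp /= eqxx.
apply/(proj1 (E _)); apply: (epsilon_spec (inhabits d0) (falsifies (interp_upto w) w)).
by case: ex => d nd; exists d; apply/(proj2 (E d)).
Qed.

Definition truth x : bool :=
  excluded_middle_informative (sat le I (env (unpair x).2) (decode (unpair x).1)).

Lemma truthP a l : truth (cpair a l) <-> sat le I (env l) (decode a).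
Proof. by rewrite /truth cpairK; case: excluded_middle_informative. Qed.

Lemma env_consc a k l :
  sat le I (env (consc k l)) a <-> sat le I (scons (interp k) (env l)) a.
Proof. by apply: sat_ext => -[|i]; rewrite /env ?nth_consc0 ?nth_consc. Qed.

Lemma truth_eqat i j : truth (eqat i j) <-> interp i = interp j.
Proof. by rewrite truthP decodeE /= /env !nth_consc0 nth_consc nth_consc0. Qed.

Lemma truth_hintikka Sigma p :
  (forall s, s \in Sigma -> forall e, sat le I e s) -> (forall e, ~ sat le I e p) ->
  hintikka (map code Sigma) (code p) truth truth.
Proof.
move=> HS Hp; do !split.
- by move=> a b l; rewrite !truthP decodeE /=; apply.
- by move=> a b l; rewrite !truthP decodeE /=.
- by move=> a b l; rewrite !truthP decodeE /=; tauto.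
- by move=> l; rewrite truthP (decodeE 3 0 0).
- by move=> a l k; rewrite !truthP decode_all /= env_consc; apply.
- move=> a l; rewrite !truthP decode_all env_consc /= => H d.
  by apply: NNPP => nd; apply: (interpS _ H); exists d.
- by move=> i; apply/truth_eqat.
- by move=> i j k /truth_eqat ij /truth_eqat ik; apply/truth_eqat; rewrite -ij.
- move=> t x y l x' y' l' t2 /truth_eqat Hx /truth_eqat Hy; rewrite !truthP !decodeE.
  by case: t t2 => [|[|//]] _ /=; rewrite /env Hx Hy.
- move=> r a a' l l' Ha; rewrite !truthP !decodeE /=.
  (* The conditions on [dropc] say that the two argument lists have equal length. *)
  have sz : size (decl a) = size (decl a').
    have sz i : (size (decl a) <= i) = (size (decl a') <= i).
      have [] := Ha i; rewrite -{1 2}(declK a) -{1 2}(declK a') !dropc_code_eq0.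
      by move=> [E E'] _; apply/idP/idP.
    by apply/eqP; rewrite eqn_leq sz leqnn -sz leqnn.
  suff -> : map (env l) (decl a) = map (env l') (decl a') by [].
  apply: (@eq_from_nth _ d0); rewrite !size_map // => i ia.
  rewrite !(nth_map 0) -?sz // /env -!nthc_code !declK; apply/truth_eqat.
  by have [_] := Ha i; apply; rewrite -(declK a) dropc_code_eq0; apply/negP; rewrite -ltnNge.
- by move=> _ /mapP[s /HS Hs ->]; rewrite truthP decodeK.
- by rewrite truthP decodeK.
Qed.
End TermModel.

(** Approximations for all [N] have a limit, whose quotient model refutes [p]; conversely, the truth
    set of a countermodel, cut off at [N], is an approximation. *)
Lemma entailsP Sigma p : all sentence Sigma -> sentence p ->
  entails Sigma p <-> ~ forall N, exists c, approx (map code Sigma) (code p) N (bits c).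
Proof.
move=> /allP sS sp; split=> [ent app|napp D d0 le I HS e].
  have [|||V HV] := @weak_konig (approx (map code Sigma) (code p)).
  - move=> N N' V NN'; apply: hintikka_sub => x.
      by case=> xN; split=> //; apply: leq_trans NN'.
    by move=> H xN; apply: H; apply: leq_trans xN NN'.
  - move=> N V V' VV'; apply: hintikka_sub => x; first by case=> xN; rewrite -VV'.
    by move=> H xN; rewrite -VV' //; apply: H.
  - by move=> N; have [c] := app N; exists (bits c).
  have H := hintikka_lim HV; have HQ := sat_Q H.
  have [_ [_ [_ [_ [_ [_ [_ [_ [_ [_ [HS Hp]]]]]]]]]]] := H.
  apply: Hp; apply/HQ; apply: ent => [|s sSig e]; first exact: (cls H 0).
  (* The Hintikka set holds the axioms only in the empty environment 0; for sentences this covers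
     every environment. *)
  apply: (proj1 (sat_bound _ _ (e := fun i => cls H (nthc 0 i)) (sS s sSig) _)) => //.
  by apply/HQ/HS/map_f.
apply: NNPP => np; apply: napp => N.
have [c cE] := bits_ex (truth d0 le I) N; exists c; rewrite /approx.
apply: hintikka_sub (truth_hintikka d0 HS (p := p) _) => [x [_]|x Hx xN|e'].
- by rewrite cE => /andP[].
- by rewrite cE xN.
(* The sentence [p] fails at [e], hence in every environment. *)
by move=> /(proj1 (sat_bound _ _ sp (e' := e) _)) H; apply: np; apply: H.
Qed.

Theorem ThY_nonfinitely_axiomatizable : inherently_nonfinitely_axiomatizable ThY.
Proof.
move=> [Sigma [sS HS]].
apply: (@tarski (fun n => ~ forall N, exists c, approx (map code Sigma) n N (bits c))).
  exact: definable_not (ndef_approx _).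
move=> p bp sp; rewrite -(entailsP sS sp) -(HS p bp sp).
by split=> [[_ []]|].
Qed.

Theorem theorem3p16 :
  ~ decidable_form ThY /\ inherently_nonfinitely_axiomatizable ThY.
Proof. by split; [apply: ThY_undecidable|apply: ThY_nonfinitely_axiomatizable]. Qed.
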